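(* Let $M=(M,\phi,\xi,\eta,g)$ be a $(2n+1)$-dimensional almost contact metric manifold, with Levi-Civita connection $\nabla$, and let $h=\frac12 L_\xi\phi$. Then $M$ is a quasi contact metric manifold if and only if $$(\nabla_X\phi)Y+(\nabla_{\phi X}\phi)\phi Y=2g(X,Y)\xi-\eta(Y)X-\eta(X)\eta(Y)\xi-\eta(Y)hX$$ for all $X,Y\in\mathfrak{X}(M)$.
   Context: $\mathfrak{X}(M)$ denotes the smooth vector fields on $M$. An almost contact metric manifold $(M,\phi,\xi,\eta,g)$ is a smooth manifold $M$ of dimension $2n+1$ with a $(1,1)$-tensor field $\phi$, a vector field $\xi$, a 1-form $\eta$ and a Riemannian metric $g$ such that, for all $X,Y\in\mathfrak{X}(M)$, $\phi^2X=-X+\eta(X)\xi$, $\phi\xi=0$, $\eta\circ\phi=0$, $\eta(\xi)=1$, $g(\phi X,\phi Y)=g(X,Y)-\eta(X)\eta(Y)$ and $\eta(X)=g(\xi,X)$. $L_\xi$ is the Lie derivative, so $(L_\xi\phi)X=[\xi,\phi X]-\phi[\xi,X]$. To $M$ one associates the almost Hermitian manifold $\bar M=M\times\mathbb{R}$ ($t$ the coordinate on $\mathbb{R}$) with almost complex structure $\bar J$ and metric $\bar g$ defined by $\bar JX=\phi X-\eta(X)\frac{\partial}{\partial t}$, $\bar J\frac{\partial}{\partial t}=\xi$, $\bar g(X,Y)=e^{-2t}g(X,Y)$, $\bar g(X,\frac{\partial}{\partial t})=0$, $\bar g(\frac{\partial}{\partial t},\frac{\partial}{\partial t})=e^{-2t}$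 for $X,Y\in\mathfrak{X}(M)$. An almost Hermitian manifold $(\bar M,\bar J,\bar g)$ with Levi-Civita connection $\bar\nabla$ is quasi Kähler if $(\bar\nabla_{U}\bar J)V+(\bar\nabla_{\bar JU}\bar J)\bar JV=0$ for all vector fields $U,V$ on $\bar M$. $M$ is called a quasi contact metric manifold if the associated $(\bar M,\bar J,\bar g)$ is quasi Kähler. *)

(* Defs.v *)
From HB Require Import structures.
From mathcomp Require Import all_boot all_order all_algebra.
From mathcomp Require Import all_classical all_reals all_analysis.

Set Implicit Arguments.
Unset Strict Implicit.
Unset Printing Implicit Defensive.

Import Order.TTheory GRing.Theory Num.Theory.
Import numFieldNormedType.Exports.

Local Open Scope classical_set_scope.
Local Open Scope ring_scope.

(* C^k and C^oo maps on an open set A.  The derivative x |-> 'd f x is tested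
   against each fixed direction v; for a finite-dimensional E this is the same
   as asking it to be C^k as a map into the continuous linear maps. *)
Fixpoint Ck (R : realType) (E F : normedModType R) (k : nat) (A : set E)
    (f : E -> F) : Prop :=
  if k is k'.+1 then
    (forall x, A x -> differentiable f x) /\
    (forall v, Ck k' A (fun x => 'd f x v))
  else {in A, continuous f}.

Definition smooth_on (R : realType) (E F : normedModType R) (A : set E)
  (f : E -> F) : Prop := forall k, Ck k A f.

Section SmoothMaps.
Context {R : realType}.

Lemma near_eq_diff (E F : normedModType R) (f g : E -> F) (x : E) :
  (\near x, f x = g x) -> differentiable f x ->
  differentiable g x /\ 'd g x = 'd f x :> (E -> F).
Proof.
move=> fg df.
have fx : f x = g x by exact: nbhs_singleton fg.
have cdf : continuous ('d f x) by exact: diff_continuous.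
have eo : g \o shift x = cst (g x) + 'd f x +o_ (0 : E) id.
  apply/eqaddoP => _/posnumP[e].
  have /eqaddoP/(_ e%:num) := diff_locally df.
  move=> /(_ (gt0 _)) fe.
  have fg0 : \forall y \near (0 : E), f (y + x) = g (y + x).
    by move: fg; rewrite (near_shift 0) /=; apply: filterS => y /=; rewrite subr0.
  apply: filterS2 fg0 fe => y /= fgy; rewrite !fctE /= -fgy -fx.
  exact.
have dg : 'd g x = 'd f x :> (E -> F) by exact: diff_unique.
split=> //; apply/diff_locallyP; rewrite dg; split=> //.
Unshelve. all: by end_near. Qed.

Lemma Ck_ext (E F : normedModType R) k (A : set E) (f g : E -> F) :
  open A -> (forall x, A x -> f x = g x) -> Ck k A f -> Ck k A g.
Proof.
move=> oA; elim: k => [|k IH] in f g * => fg /=.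
  move=> cf x Ax.
  have Ax' : A x by rewrite inE in Ax.
  have nfg : \near x, f x = g x.
    by apply: filterS (open_nbhs_nbhs (conj oA Ax')) => y /fg.
  rewrite /continuous_at -(fg _ Ax').
  apply: cvg_trans (cf _ Ax); apply: near_eq_cvg.
  by apply: filterS nfg => y ->.
move=> [df cf].
have nfg x : A x -> \near x, f x = g x.
  by move=> Ax; apply: filterS (open_nbhs_nbhs (conj oA Ax)) => y /fg.
split=> [x Ax|v]; first by case: (near_eq_diff (nfg _ Ax) (df _ Ax)).
apply: IH (cf v) => x Ax.
by case: (near_eq_diff (nfg _ Ax) (df _ Ax)) => _ ->.
Qed.

Lemma Ck_cst (E F : normedModType R) k (A : set E) (a : F) :
  Ck k A (cst a : E -> F).
Proof.
elim: k a => [|k IH] a /=; first by move=> x _; exact: cvg_cst.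
split=> [x _|v]; first exact: differentiable_cst.
have -> : (fun x : E => 'd (cst a : E -> F) x v) = cst 0 by
  apply/funext => x; rewrite diff_cst.
exact: IH.
Qed.

Lemma fst_cont (E E' : normedModType R) : continuous (@fst E E').
Proof. by move=> x; exact: cvg_fst. Qed.

Lemma snd_cont (E E' : normedModType R) : continuous (@snd E E').
Proof. by move=> x; exact: cvg_snd. Qed.

Lemma fst_is_linear (E E' : normedModType R) : linear (@fst E E').
Proof. by []. Qed.

Lemma snd_is_linear (E E' : normedModType R) : linear (@snd E E').
Proof. by []. Qed.

Lemma diff_fst (E E' : normedModType R) (z : E * E') :
  differentiable (@fst E E') z /\ 'd (@fst E E') z = @fst E E' :> (_ -> _).
Proof.
pose m := GRing.isLinear.Build _ _ _ _ _ (@fst_is_linear E E').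
pose l : {linear _ -> _} := HB.pack (@fst E E') m.
by split; [apply: (@linear_differentiable _ _ _ l)|apply: (@diff_lin _ _ _ l)];
  exact: fst_cont.
Qed.

Lemma diff_snd (E E' : normedModType R) (z : E * E') :
  differentiable (@snd E E') z /\ 'd (@snd E E') z = @snd E E' :> (_ -> _).
Proof.
pose m := GRing.isLinear.Build _ _ _ _ _ (@snd_is_linear E E').
pose l : {linear _ -> _} := HB.pack (@snd E E') m.
by split; [apply: (@linear_differentiable _ _ _ l)|apply: (@diff_lin _ _ _ l)];
  exact: snd_cont.
Qed.

Lemma Ck_pair (E F G : normedModType R) k (A : set E) (f : E -> F)
    (g : E -> G) :
  open A -> Ck k A f -> Ck k A g -> Ck k A (fun x => (f x, g x)).
Proof.
move=> oA; elim: k => [|k IH] /= in f g *.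
  by move=> cf cg x Ax; apply: cvg_pair; [exact: cf|exact: cg].
move=> [df cf] [dg cg]; split=> [x Ax|v].
  by apply: differentiable_pair; [exact: df|exact: dg].
apply: Ck_ext (IH _ _ (cf v) (cg v)) => // x Ax.
by rewrite diff_pair //; [exact: df|exact: dg].
Qed.

Lemma Ck_fst (E E' F : normedModType R) k (A : set E) (f : E -> F) :
  open A -> Ck k A f -> Ck k (A `*` [set: E']) (f \o fst).
Proof.
move=> oA; have oAT : open (A `*` [set: E']).
  rewrite (_ : _ `*` _ = fst @^-1` A); last first.
    by apply/seteqP; split => -[x y] //= [].
  by apply: open_comp => // z _; exact: fst_cont.
elim: k => [|k IH] /= in f *.
  move=> cf z; rewrite inE => -[Az _]; apply: continuous_comp.
    exact: fst_cont.
  by apply: cf; rewrite inE.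
move=> [df cf]; split=> [z [Az _]|v].
  by apply: differentiable_comp; [case: (diff_fst z)|exact: df].
apply: Ck_ext (IH _ (cf v.1)) => // z [Az _].
by rewrite diff_comp /=; [case: (diff_fst z) => _ ->| case: (diff_fst z)|exact: df].
Qed.

Lemma Ck_snd (E E' : normedModType R) k (A : set (E * E')) :
  Ck k A snd.
Proof.
case: k => [|k] /=; first by move=> z _; exact: snd_cont.
split=> [z _|v]; first by case: (diff_snd z).
have -> : (fun x : E * E' => 'd (@snd E E') x v) = cst v.2.
  by apply/funext => x; case: (diff_snd x) => _ ->.
exact: Ck_cst.
Qed.

End SmoothMaps.

Record chart (R : realType) (T : topologicalType) (E : normedModType R) :=
  Chart {
  cdom : set T;
  ccod : set E;
  cmap :> T -> E;
  cinv : E -> T;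
  cdom_open : open cdom;
  ccod_open : open ccod;
  cmap_cod : forall p, cdom p -> ccod (cmap p);
  cinv_dom : forall x, ccod x -> cdom (cinv x);
  cmapK : forall p, cdom p -> cinv (cmap p) = p;
  cinvK : forall x, ccod x -> cmap (cinv x) = x;
  cmap_cont : {in cdom, continuous cmap};
  cinv_cont : {in ccod, continuous cinv} }.

Definition transition (R : realType) (T : topologicalType)
  (E : normedModType R) (c d : chart T E) : E -> E := d \o cinv c.

Definition overlap (R : realType) (T : topologicalType)
  (E : normedModType R) (c d : chart T E) : set E :=
  ccod c `&` (cinv c @^-1` cdom d).

(* Smooth manifolds modelled on E (finite-dimensional in all uses).
   chart_at selects a preferred chart around each point; it carries no
   mathematical content and serves to realize tangent spaces, see below. *)
Record manifold (R : realType) (E : normedModType R) := Manifold {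
  carrier :> topologicalType;
  atlas : set (chart carrier E);
  chart_at : carrier -> chart carrier E;
  manifold_hausdorff : hausdorff_space carrier;
  manifold_second_countable : @second_countable carrier;
  chart_at_atlas : forall p, atlas (chart_at p);
  chart_at_dom : forall p, cdom (chart_at p) p;
  atlas_smooth : forall c d, atlas c -> atlas d ->
    smooth_on (overlap c d) (transition c d) }.

Section Calculus.
Context {R : realType} {E : normedModType R} (M : manifold E).

(* The tangent space at p is E, a tangent vector being represented by its
   components in the chart chart_at p; tcoord c p converts these into
   components in another chart c around p.  Fields are plain functions on M;
   smoothness is the separate predicate smooth_vfield, saying that the
   components in every chart of the atlas are smooth. *)
Definition vfield := M -> E.

Definition tcoord (c : chart M E) (p : M) : E -> E :=
  'd (transition (chart_at p) c) (chart_at p p).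

Definition vlocal (c : chart M E) (X : vfield) : E -> E :=
  fun x => tcoord c (cinv c x) (X (cinv c x)).

Definition smooth_fun (f : M -> R) : Prop :=
  forall c, atlas c -> smooth_on (ccod c) (f \o cinv c).

Definition smooth_vfield (X : vfield) : Prop :=
  forall c, atlas c -> smooth_on (ccod c) (vlocal c X).

(* X f, computed in the chart chart_at p *)
Definition lie_fun (X : vfield) (f : M -> R) : M -> R :=
  fun p => 'd (f \o cinv (chart_at p)) (chart_at p p) (X p).

(* [X, Y]^k = X^i d_i Y^k - Y^i d_i X^k, in the chart chart_at p *)
Definition lie_bracket (X Y : vfield) : vfield :=
  fun p => let c := chart_at p in
    'd (vlocal c Y) (c p) (X p) - 'd (vlocal c X) (c p) (Y p).

Definition act (phi : M -> E -> E) (X : vfield) : vfield :=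
  fun p => phi p (X p).

Definition pairing (eta : M -> E -> R) (X : vfield) : M -> R :=
  fun p => eta p (X p).

Record is_endo_field (phi : M -> E -> E) : Prop := IsEndoField {
  endo_linear : forall p, linear (phi p);
  endo_smooth : forall X, smooth_vfield X -> smooth_vfield (act phi X) }.

Record is_one_form (eta : M -> E -> R) : Prop := IsOneForm {
  form_linear : forall p, scalar (eta p);
  form_smooth : forall X, smooth_vfield X -> smooth_fun (pairing eta X) }.

Definition inner (g : M -> E -> E -> R) (X Y : vfield) : M -> R :=
  fun p => g p (X p) (Y p).

Record is_riemannian_metric (g : M -> E -> E -> R) : Prop :=
  IsRiemannianMetric {
  metric_linear : forall p u, scalar (g p u);
  metric_sym : forall p u v, g p u v = g p v u;
  metric_pos : forall p u, u != 0 -> 0 < g p u u;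
  metric_smooth : forall X Y, smooth_vfield X -> smooth_vfield Y ->
    smooth_fun (inner g X Y) }.

(* A connection is a total operation on fields, constrained (and meaningful)
   on smooth vector fields only. *)
Record is_affine_connection (nab : vfield -> vfield -> vfield) : Prop :=
  IsAffineConnection {
  conn_smooth : forall X Y, smooth_vfield X -> smooth_vfield Y ->
    smooth_vfield (nab X Y);
  connDl : forall X X' Y, smooth_vfield X -> smooth_vfield X' ->
    smooth_vfield Y -> forall p, nab (X \+ X') Y p = nab X Y p + nab X' Y p;
  connZl : forall f X Y, smooth_fun f -> smooth_vfield X -> smooth_vfield Y ->
    forall p, nab (fun q => f q *: X q) Y p = f p *: nab X Y p;
  connDr : forall X Y Y', smooth_vfield X -> smooth_vfield Y ->
    smooth_vfield Y' -> forall p, nab X (Y \+ Y') p = nab X Y p + nab X Y' p;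
  conn_leibniz : forall f X Y, smooth_fun f -> smooth_vfield X ->
    smooth_vfield Y -> forall p,
    nab X (fun q => f q *: Y q) p = lie_fun X f p *: Y p + f p *: nab X Y p }.

Record is_levi_civita (g : M -> E -> E -> R)
    (nab : vfield -> vfield -> vfield) : Prop := IsLeviCivita {
  lc_connection : is_affine_connection nab;
  lc_torsion_free : forall X Y, smooth_vfield X -> smooth_vfield Y ->
    forall p, nab X Y p - nab Y X p = lie_bracket X Y p;
  lc_metric : forall X Y Z, smooth_vfield X -> smooth_vfield Y ->
    smooth_vfield Z -> forall p,
    lie_fun X (inner g Y Z) p = g p (nab X Y p) (Z p) + g p (Y p) (nab X Z p) }.

(* (nab_X phi) Y = nab_X (phi Y) - phi (nab_X Y) *)
Definition cov_endo (nab : vfield -> vfield -> vfield) (phi : M -> E -> E)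
  (X Y : vfield) : vfield :=
  fun p => nab X (act phi Y) p - phi p (nab X Y p).

(* (L_X phi) Y *)
Definition lie_endo (X : vfield) (phi : M -> E -> E) (Y : vfield) : vfield :=
  fun p => lie_bracket X (act phi Y) p - phi p (lie_bracket X Y p).

(* (M, J, g) is quasi Kaehler, nab being the Levi-Civita connection of g *)
Definition quasi_kaehler (J : M -> E -> E)
    (nab : vfield -> vfield -> vfield) : Prop :=
  forall U V, smooth_vfield U -> smooth_vfield V ->
  forall p, cov_endo nab J U V p
            + cov_endo nab J (act J U) (act J V) p = 0.

Record almost_contact_metric (phi : M -> E -> E) (xi : vfield)
    (eta : M -> E -> R) (g : M -> E -> E -> R) : Prop :=
  AlmostContactMetric {
  acm_phi : is_endo_field phi;
  acm_xi : smooth_vfield xi;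
  acm_eta : is_one_form eta;
  acm_g : is_riemannian_metric g;
  acm_phi2 : forall X, smooth_vfield X -> forall p,
    phi p (phi p (X p)) = - X p + eta p (X p) *: xi p;
  acm_phi_xi : forall p, phi p (xi p) = 0;
  acm_eta_phi : forall X, smooth_vfield X -> forall p,
    eta p (phi p (X p)) = 0;
  acm_eta_xi : forall p, eta p (xi p) = 1;
  acm_compat : forall X Y, smooth_vfield X -> smooth_vfield Y -> forall p,
    g p (phi p (X p)) (phi p (Y p)) =
    g p (X p) (Y p) - eta p (X p) * eta p (Y p);
  acm_dual : forall X, smooth_vfield X -> forall p,
    eta p (X p) = g p (xi p) (X p) }.

(* h = (1/2) L_xi phi *)
Definition h_tensor (phi : M -> E -> E) (xi X : vfield) : vfield :=
  fun p => 2^-1 *: lie_endo xi phi X p.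

End Calculus.

Section TopologicalProduct.
Context {R : realType} {T : topologicalType}.

Lemma hausdorff_prod (T' : topologicalType) :
  hausdorff_space T -> hausdorff_space T' -> hausdorff_space (T * T')%type.
Proof.
move=> hT hT' [x x'] [y y'] cxy; congr (_, _).
  apply: hT => A B Ax By; have [||[z z'] [Az Bz]] := cxy (fst @^-1` A) (fst @^-1` B).
  - by apply: (cvg_fst (F := nbhs x) (G := nbhs x')).
  - by apply: (cvg_fst (F := nbhs y) (G := nbhs y')).
  by exists z.
apply: hT' => A B Ax By; have [||[z z'] [Az Bz]] := cxy (snd @^-1` A) (snd @^-1` B).
- by apply: (cvg_snd (F := nbhs x) (G := nbhs x')).
- by apply: (cvg_snd (F := nbhs y) (G := nbhs y')).
by exists z'.
Qed.

Lemma open_setX (T' : topologicalType) (A : set T) (B : set T') :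
  open A -> open B -> open (A `*` B).
Proof.
move=> oA oB; rewrite openE => -[x y] [/= Ax By].
exists (A, B) => //=; split; exact: open_nbhs_nbhs.
Qed.

Lemma second_countable_prod (T' : topologicalType) :
  @second_countable T -> @second_countable T' ->
  @second_countable (T * T')%type.
Proof.
move=> [B cB [oB bB]] [B' cB' [oB' bB']].
exists ((fun U => U.1 `*` U.2) @` (B `*` B')).
  by apply: card_le_trans (card_image_le _ _) _; exact: countableX.
split; first by move=> _ [[U V] [/= /oB oU /oB' oV] <-]; exact: open_setX.
move=> [x y] A [[P Q] /= [Px Qy] PQA].
have [U [BU Ux] UP] := bB _ _ Px.
have [V [BV Vy] VQ] := bB' _ _ Qy.
exists (U `*` V); first by split=> //; exists (U, V).
by move=> [a b] [/= Ua Vb]; apply: PQA; split; [exact: UP|exact: VQ].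
Qed.

Lemma second_countable_real : @second_countable R.
Proof.
exists ((fun q : rat * rat => `]ratr q.1, ratr q.2[%classic) @` setT).
  by apply: card_le_trans (card_image_le _ _) _; exact: countableP.
split; first by move=> _ [q _ <-]; exact: interval_open.
move=> x A /nbhs_ballP[e /= e0 eA].
have /rat_in_itvoo[q qx] : x - e < x by rewrite ltrBlDr ltrDl.
have /rat_in_itvoo[r rx] : x < x + e by rewrite ltrDl.
move: qx rx; rewrite !in_itv /= => /andP[q1 q2] /andP[r1 r2].
exists `]ratr q, ratr r[%classic.
  by split; [exists (q, r)|rewrite /= in_itv /= q2 r1].
move=> y; rewrite /= in_itv /= => /andP[qy yr]; apply: eA.
by rewrite /ball /= ltr_distlC (lt_trans q1 qy) (lt_trans yr r2).
Qed.

End TopologicalProduct.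

Section ProductWithLine.
Context {R : realType} {E : normedModType R}.

Section ProductChart.
Context {T : topologicalType} (c : chart T E).

Definition line_map (z : T * R) : E * R := (c z.1, z.2).
Definition line_inv (z : E * R) : T * R := (cinv c z.1, z.2).

Lemma line_map_cont : {in cdom c `*` setT, continuous line_map}.
Proof.
move=> z; rewrite inE => -[cz _].
have cf : {for z, continuous (c \o fst)}.
  apply: continuous_comp; first by exact: cvg_fst.
  by apply: cmap_cont; rewrite inE.
exact: (cvg_pair cf cvg_snd).
Qed.

Lemma line_inv_cont : {in ccod c `*` setT, continuous line_inv}.
Proof.
move=> z; rewrite inE => -[cz _].
have cf : {for z, continuous (cinv c \o fst)}.
  apply: continuous_comp; first by exact: cvg_fst.
  by apply: cinv_cont; rewrite inE.
exact: (cvg_pair cf cvg_snd).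
Qed.

Lemma line_map_cod z : (cdom c `*` setT) z -> (ccod c `*` setT) (line_map z).
Proof. by move=> [cz _]; split=> //; exact: cmap_cod. Qed.

Lemma line_inv_dom z : (ccod c `*` setT) z -> (cdom c `*` setT) (line_inv z).
Proof. by move=> [cz _]; split=> //; exact: cinv_dom. Qed.

Lemma line_mapK z : (cdom c `*` setT) z -> line_inv (line_map z) = z.
Proof. by case: z => p t [cp _]; rewrite /line_inv /= cmapK. Qed.

Lemma line_invK z : (ccod c `*` setT) z -> line_map (line_inv z) = z.
Proof. by case: z => x t [cx _]; rewrite /line_map /= cinvK. Qed.

Definition line_chart : chart (T * R)%type (E * R)%type :=
  Chart (open_setX (cdom_open c) openT) (open_setX (ccod_open c) openT)
    line_map_cod line_inv_dom line_mapK line_invK line_map_cont line_inv_cont.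

End ProductChart.

Lemma overlap_open (T : topologicalType) (c d : chart T E) :
  open (overlap c d).
Proof.
rewrite openE => x [cx dx]; apply: filterI.
  by apply: open_nbhs_nbhs; split=> //; exact: ccod_open.
have cc : {for x, continuous (cinv c)} by apply: cinv_cont; rewrite inE.
by apply: cc; apply: open_nbhs_nbhs; split=> //; exact: cdom_open.
Qed.

Context (M : manifold E).

Definition line_atlas : set (chart (M * R)%type (E * R)%type) :=
  [set line_chart c | c in @atlas _ _ M].

Definition line_chart_at (z : M * R) : chart (M * R)%type (E * R)%type :=
  line_chart (chart_at z.1).

Lemma line_chart_at_atlas z : line_atlas (line_chart_at z).
Proof. by exists (chart_at z.1) => //; exact: chart_at_atlas. Qed.

Lemma line_chart_at_dom z : cdom (line_chart_at z) z.
Proof. by split=> //; exact: chart_at_dom. Qed.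

Lemma line_atlas_smooth c d : line_atlas c -> line_atlas d ->
  smooth_on (overlap c d) (transition c d).
Proof.
move=> [c' ac <-] [d' ad <-] k.
have oO := overlap_open c' d'.
rewrite (_ : overlap _ _ = overlap c' d' `*` setT); last first.
  by apply/seteqP; split=> z [/=] => [[cz _] [dz _]|[cz dz] _].
have C1 := Ck_fst R oO (atlas_smooth ac ad k).
exact: (Ck_pair (open_setX oO openT) C1 (@Ck_snd _ _ _ _ _)).
Qed.

(* M x R, with atlas and preferred charts c x id *)
Definition line_product : manifold (E * R)%type :=
  Manifold
    (hausdorff_prod (@manifold_hausdorff _ _ M) (@Rhausdorff R))
    (second_countable_prod (@manifold_second_countable _ _ M)
       (@second_countable_real R))
    line_chart_at_atlas line_chart_at_dom line_atlas_smooth.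

End ProductWithLine.

Section Cone.
Context {R : realType} {E : normedModType R} (M : manifold E).

(* The preferred charts of line_product M being chart_at p x id, the pair
   (u, a) : E * R is the tangent vector u + a d/dt at (p, t).  cone_J and
   cone_metric are the fibrewise linear extensions of
     J X = phi X - eta(X) d/dt,   J d/dt = xi,
     gbar(X, Y) = e^(-2t) g(X, Y),   gbar(X, d/dt) = 0,
     gbar(d/dt, d/dt) = e^(-2t). *)
Definition cone_J (phi : M -> E -> E) (xi : vfield M) (eta : M -> E -> R) :
    line_product M -> E * R -> E * R :=
  fun z w => (phi z.1 w.1 + w.2 *: xi z.1, - eta z.1 w.1).

Definition cone_metric (g : M -> E -> E -> R) :
    line_product M -> E * R -> E * R -> R :=
  fun z w w' => expR (- 2 * z.2) * (g z.1 w.1 w'.1 + w.2 * w'.2).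

(* nabbar is the Levi-Civita connection of cone_metric g *)
Definition quasi_contact_metric (phi : M -> E -> E) (xi : vfield M)
    (eta : M -> E -> R)
    (nabbar : vfield (line_product M) -> vfield (line_product M) ->
              vfield (line_product M)) : Prop :=
  quasi_kaehler (cone_J phi xi eta) nabbar.

End Cone.

(* Main.v *)
Require Import Defs.
From HB Require Import structures.
From mathcomp Require Import all_boot all_order all_algebra.
From mathcomp Require Import all_classical all_reals all_analysis.
From mathcomp Require Import ring lra.
Set Implicit Arguments.
Unset Strict Implicit.
Unset Printing Implicit Defensive.
Import Order.TTheory GRing.Theory Num.Theory.
Import numFieldNormedType.Exports.
Local Open Scope classical_set_scope.
Local Open Scope ring_scope.

(** The metric of M x R is conformal to a product, so its Levi-Civita connection
    is explicit in terms of nabla: with X, Y the components along M of U, V and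
    a, b their d/dt-components, all viewed as families depending on t,
      nablabar_U V = nabla_X Y + a d_t Y - b X - a Y
                     + (U(b) + g(X, Y) - a b) d/dt.
    This operation (cone_conn) is torsion-free and metric, and therefore agrees
    with nablabar by the usual uniqueness argument (cone_connE).  Substituting
    it, all derivatives in t cancel from nablabar J (cov_cone_J), and the quasi
    Kaehler tensor becomes an expression in nabla, phi, xi, eta, g
    (quasi_kaehler_tensor).  Its vanishing for all U, V amounts to that of its
    tangential part for a = b = 0,
      (nabla_X phi) Y + (nabla_{phi X} phi) phi Y
        = 2 g(X, Y) xi - 2 eta(Y) X + eta(Y) nabla_{phi X} xi,
    since Y = xi and X = xi in this equation control the remaining terms
    (quasi_kaehler_reduced).  On the other hand
      2 h X = (nabla_xi phi) X - nabla_{phi X} xi + phi nabla_X xi,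
    and either this equation or the one in the theorem gives nabla_xi phi = 0
    and h X = X - eta(X) xi - nabla_{phi X} xi, which makes the two equal
    (reduced_h_identity).

    The analytic work lies in the passage between M and M x R.  Smoothness of
    phi, eta and g is a condition on global smooth fields of M, whereas on M x R
    they are applied to fields whose components depend jointly on the point and
    on t.  Bump functions provide global fields with prescribed constant
    components near a point (extend_vfield), so the components of these tensors
    in charts are smooth (Ck_components), and the calculus of C^k maps shows
    that cone_J preserves smooth fields and that inner products of smooth fields
    on M x R are differentiable.  The same extensions turn identities between
    fields into identities between tangent vectors. *)

(** * Calculus of C^k maps *)

Section LinearMaps.
Context {R : realType}.
Implicit Types E F G H : normedModType R.

Lemma scale_is_bilinear F : bilinear_for
  (GRing.Scale.Law.clone _ _ *:%R _) (GRing.Scale.Law.clone _ _ *:%R _)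
  (fun (a : R) (u : F) => a *: u).
Proof.
split=> [u'|u] a x y /=; first by rewrite scalerDl scalerA.
by rewrite scalerDr !scalerA mulrC.
Qed.

Lemma is_diff_scale F (p : R * F) :
  differentiable (fun q : R * F => q.1 *: q.2) p /\
  'd (fun q : R * F => q.1 *: q.2) p =
    (fun q => p.1 *: q.2 + q.1 *: p.2) :> (R * F -> F).
Proof.
pose m := bilinear_isBilinear.Build R R F F _ _ _ (scale_is_bilinear F).
pose b : {bilinear R -> F -> F} := HB.pack (fun (a : R) (u : F) => a *: u) m.
have cb : continuous (fun q : R * F => b q.1 q.2).
  by move=> q; exact: (@scale_continuous R F).
by split; [exact: (differentiable_bilin p cb)|exact: (diff_bilin p cb)].
Qed.

Lemma diff_scale E F (a : E -> R) (f : E -> F) x :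
  differentiable a x -> differentiable f x ->
  differentiable (fun y => a y *: f y) x /\
  'd (fun y => a y *: f y) x = (fun v => 'd a x v *: f x + a x *: 'd f x v)
    :> (E -> F).
Proof.
move=> da df.
have dp : differentiable (fun y => (a y, f y)) x by exact: differentiable_pair.
have [ds Ds] := is_diff_scale (a x, f x).
have dc := differentiable_comp dp ds; have Dc := diff_comp dp ds.
split; first exact: dc.
by rewrite [LHS]Dc; apply/funext => v; rewrite /= Ds diff_pair //= addrC.
Qed.

Definition linear_of E F (f : E -> F) (lf : linear f) : {linear E -> F} :=
  HB.pack f (GRing.isLinear.Build _ _ _ _ _ lf).

Lemma diff_linear E F (f : E -> F) (x : E) : linear f -> continuous f ->
  differentiable f x /\ 'd f x = f :> (E -> F).
Proof.
move=> lf cf; pose l := linear_of lf.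
by split; [exact: (@linear_differentiable _ _ _ l)|exact: (@diff_lin _ _ _ l)].
Qed.

Lemma diff_linear_comp E F G (l : F -> G) (f : E -> F) (x : E) :
  linear l -> continuous l -> differentiable f x ->
  differentiable (fun y => l (f y)) x /\
  'd (fun y => l (f y)) x = (fun v => l ('d f x v)) :> (E -> G).
Proof.
move=> ll cl df; have [dl Dl] := diff_linear (f x) ll cl.
split; first exact: (differentiable_comp df dl).
by rewrite (diff_comp df dl) Dl.
Qed.

Lemma diff_addf E F (f g : E -> F) (x : E) :
  differentiable f x -> differentiable g x ->
  differentiable (fun y => f y + g y) x /\
  'd (fun y => f y + g y) x = (fun v => 'd f x v + 'd g x v) :> (E -> F).
Proof.
by move=> df dg; split; [exact: (differentiableD df dg)|exact: (diffD df dg)].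
Qed.

Lemma diff_affine E F (l : E -> F) (b : F) (x : E) :
  linear l -> continuous l -> differentiable (fun y => l y + b) x /\
  'd (fun y => l y + b) x = l :> (E -> F).
Proof.
move=> ll cl; have [dl Dl] := diff_linear x ll cl.
have db := differentiable_cst b x.
have [d D] := diff_addf dl db; split=> //.
by rewrite D Dl diff_cst; apply/funext => v; rewrite addr0.
Qed.

Lemma diff_affine_comp E F G (f : F -> G) (l : E -> F) (b : F) (x : E) :
  linear l -> continuous l -> differentiable f (l x + b) ->
  differentiable (fun y => f (l y + b)) x /\
  'd (fun y => f (l y + b)) x = (fun v => 'd f (l x + b) (l v)) :> (E -> G).
Proof.
move=> ll cl df; have [da Da] := diff_affine b x ll cl.
split; first exact: (@differentiable_comp _ _ _ _ (fun y => l y + b) f _ da df).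
by rewrite (@diff_comp _ _ _ _ (fun y => l y + b) f _ da df) Da.
Qed.

(** Finite dimension is used only through a finite system of continuous
    coordinates. *)
Definition finite_coords F := exists m (e : 'I_m -> F) (l : 'I_m -> F -> R),
  (forall i, linear (l i) /\ continuous (l i)) /\
  (forall v, v = \sum_i l i v *: e i).

Lemma finite_coords_rV m : finite_coords 'rV[R]_m.
Proof.
exists m, (fun i => delta_mx 0 i), (fun i (v : 'rV[R]_m) => v 0 i); split=> [i|v].
  by split=> [a u v|u]; [rewrite !mxE|exact: coord_continuous].
exact: row_sum_delta.
Qed.

Lemma finite_coords_real : finite_coords R.
Proof.
exists 1%N, (fun=> 1), (fun=> id); split=> [i|v].
  by split=> // v; exact: cvg_id.
by rewrite big_ord1 [RHS]mulr1.
Qed.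

Lemma linear_sumZ F G (f : F -> G) m (a : 'I_m -> R) (e : 'I_m -> F) :
  linear f -> f (\sum_i a i *: e i) = \sum_i a i *: f (e i).
Proof.
move=> lf; rewrite -[f]/(linear_of lf : _ -> _) linear_sum.
by apply: eq_bigr => i _; rewrite linearZ.
Qed.

Lemma continuous_sumf (T : topologicalType) G m (f : 'I_m -> T -> G) (x : T) :
  (forall i, {for x, continuous (f i)}) ->
  {for x, continuous (fun y => \sum_i f i y)}.
Proof.
elim: m f => [|m IH] f cf.
  rewrite (_ : (fun _ => _) = cst 0); first exact: cvg_cst.
  by apply/funext => y; rewrite big_ord0.
rewrite (_ : (fun _ => _) =
  (fun y => \sum_(i < m) f (widen_ord (leqnSn m) i) y + f ord_max y)).
  by apply: cvgD; [apply: IH => i|]; exact: cf.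
by apply/funext => y; rewrite big_ord_recr.
Qed.

Lemma linear_continuous F G (f : F -> G) :
  finite_coords F -> linear f -> continuous f.
Proof.
move=> [m [e [l [ll el]]]] lf.
have -> : f = fun v => \sum_i l i v *: f (e i).
  by apply/funext => v; rewrite {1}(el v) linear_sumZ.
move=> v; apply: continuous_sumf => i.
by apply: cvgZr_tmp; exact: (ll i).2.
Qed.

End LinearMaps.

Section CkCalculus.
Context {R : realType}.
Implicit Types E F G H : normedModType R.

Lemma CkW E F k (A : set E) (f : E -> F) : Ck k.+1 A f -> Ck k A f.
Proof.
elim: k f => [|k IH] f [df cf].
  by move=> x; rewrite inE => /df; exact: differentiable_continuous.
by split=> // v; exact: IH.
Qed.

Lemma CkS E F k (A B : set E) (f : E -> F) :
  B `<=` A -> Ck k A f -> Ck k B f.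
Proof.
move=> BA; elim: k f => [|k IH] f /=.
  by move=> cf x; rewrite inE => /BA Ax; apply: cf; rewrite inE.
by move=> [df cf]; split=> [x /BA /df //|v]; exact: IH.
Qed.

(** Differentials are taken in the ambient space, independently of the set on
    which they are tested. *)
Lemma Ck_local E F k (A : set E) (f : E -> F) :
  (forall x, A x -> exists B, B x /\ Ck k B f) -> Ck k A f.
Proof.
elim: k f => [|k IH] f fA /=.
  move=> x; rewrite inE => /fA[B [Bx cf]].
  by apply: cf; rewrite inE.
split=> [x /fA[B [Bx [df _]]]|v]; first exact: df.
by apply: IH => x /fA[B [Bx [_ cf]]]; exists B; split=> //; exact: cf.
Qed.

Lemma Ck_linear E F k (A : set E) (f : E -> F) :
  linear f -> continuous f -> Ck k A f.
Proof.
move=> lf cf; case: k => [|k]; first by move=> x _; exact: cf.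
split=> [x _|v]; first by have [] := diff_linear x lf cf.
rewrite (_ : (fun _ => _) = cst (f v)); first exact: Ck_cst.
by apply/funext => x; have [_ ->] := diff_linear x lf cf.
Qed.

Lemma Ck_linear_comp E F G k (A : set E) (l : F -> G) (f : E -> F) :
  open A -> linear l -> continuous l -> Ck k A f -> Ck k A (fun x => l (f x)).
Proof.
move=> oA ll cl; elim: k f => [|k IH] f /=.
  by move=> cf x Ax; apply: continuous_comp; [exact: cf|exact: cl].
move=> [df cf]; split=> [x Ax|v].
  by case: (diff_linear_comp ll cl (df x Ax)).
apply: Ck_ext (IH _ (cf v)) => // x Ax.
by case: (diff_linear_comp ll cl (df x Ax)) => _ ->.
Qed.

Lemma Ck_add E F k (A : set E) (f g : E -> F) :
  open A -> Ck k A f -> Ck k A g -> Ck k A (fun x => f x + g x).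
Proof.
move=> oA; elim: k f g => [|k IH] f g /=.
  by move=> cf cg x Ax; apply: cvgD; [exact: cf|exact: cg].
move=> [df cf] [dg cg]; split=> [x Ax|v].
  by case: (diff_addf (df x Ax) (dg x Ax)).
apply: Ck_ext (IH _ _ (cf v) (cg v)) => // x Ax.
by case: (diff_addf (df x Ax) (dg x Ax)) => _ ->.
Qed.

Lemma Ck_sum E F k (A : set E) m (f : 'I_m -> E -> F) :
  open A -> (forall i, Ck k A (f i)) -> Ck k A (fun x => \sum_i f i x).
Proof.
move=> oA; elim: m f => [|m IH] f cf.
  rewrite (_ : (fun _ => _) = cst 0); first exact: Ck_cst.
  by apply/funext => x; rewrite big_ord0.
rewrite (_ : (fun _ => _) =
  fun x => \sum_(i < m) f (widen_ord (leqnSn m) i) x + f ord_max x).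
  by apply: Ck_add => //; exact: (IH (fun i => f (widen_ord (leqnSn m) i))).
by apply/funext => x; rewrite big_ord_recr.
Qed.

Lemma Ck_scale E F k (A : set E) (a : E -> R) (f : E -> F) :
  open A -> Ck k A a -> Ck k A f -> Ck k A (fun x => a x *: f x).
Proof.
move=> oA; elim: k a f => [|k IH] a f.
  by move=> ca cf x Ax; apply: cvgZ; [exact: ca|exact: cf].
move=> Ca Cf; have [da ca] := Ca; have [df cf] := Cf; split=> [x Ax|v].
  by case: (diff_scale (da x Ax) (df x Ax)).
have Cd := Ck_add oA (IH _ _ (ca v) (CkW Cf)) (IH _ _ (CkW Ca) (cf v)).
apply: Ck_ext Cd => // x Ax.
by case: (diff_scale (da x Ax) (df x Ax)) => _ ->.
Qed.

Lemma Ck_affine_comp E F G k (A : set F) (f : F -> G) (l : E -> F) (b : F) :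
  linear l -> continuous l -> open A -> Ck k A f ->
  Ck k [set x | A (l x + b)] (fun x => f (l x + b)).
Proof.
move=> ll cl oA.
have oB : open [set x | A (l x + b)].
  apply: (@open_comp _ _ (fun x => l x + b)) => // x _.
  by apply: cvgD; [exact: cl|exact: cvg_cst].
elim: k f => [|k IH] f /=.
  move=> cf x; rewrite inE => Ax.
  apply: (@continuous_comp _ _ _ (fun x => l x + b) f).
    by apply: cvgD; [exact: cl|exact: cvg_cst].
  by apply: cf; rewrite inE.
move=> [df cf]; split=> [x Ax|v].
  by case: (diff_affine_comp ll cl (df _ Ax)).
apply: Ck_ext (IH _ (cf (l v))) => // x Ax.
by case: (diff_affine_comp ll cl (df _ Ax)) => _ ->.
Qed.

(** The derivative of a composite is the derivative of g at f x applied to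
    that of f; expanding the latter in coordinates turns it into a sum of
    products of composites and C^k maps, so that induction applies. *)
Lemma Ck_comp E F G k (A : set E) (B : set F) (f : E -> F) (g : F -> G) :
  finite_coords F -> open A -> (forall x, A x -> B (f x)) ->
  Ck k A f -> Ck k B g -> Ck k A (fun x => g (f x)).
Proof.
move=> [m [e [l [ll el]]]] oA AB; elim: k f g AB => [|k IH] f g AB.
  move=> cf cg x Ax; rewrite inE in Ax; apply: continuous_comp.
    by apply: cf; rewrite inE.
  by apply: cg; rewrite inE; exact: AB.
move=> Cf [dg cg]; have [df cf] := Cf; split=> [x Ax|v].
  by apply: (@differentiable_comp _ _ _ _ f g); [exact: df|exact/dg/AB].
have Cd : Ck k A (fun x => \sum_i l i ('d f x v) *: 'd g (f x) (e i)).
  apply: Ck_sum => // i; apply: Ck_scale => //.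
    by apply: Ck_linear_comp => //; [exact: (ll i).1|exact: (ll i).2|exact: cf].
  exact: (IH f (fun y => 'd g y (e i)) AB (CkW Cf) (cg (e i))).
apply: Ck_ext Cd => // x Ax.
rewrite (@diff_comp _ _ _ _ f g); [|exact: df|exact/dg/AB].
by rewrite /= [in RHS](el ('d f x v)) linear_sum;
  apply: eq_bigr => i _; rewrite linearZ.
Qed.

(** Expanding w z in coordinates reduces to the values of T on fixed vectors. *)
Lemma Ck_app E F H k (B : set H) (T : H -> E -> F) (w : H -> E) :
  finite_coords E -> open B -> (forall z, B z -> linear (T z)) ->
  (forall u, Ck k B (T^~ u)) -> Ck k B w -> Ck k B (fun z => T z (w z)).
Proof.
move=> [m [e [l [ll el]]]] oB lT CT Cw.
have Cs : Ck k B (fun z => \sum_i l i (w z) *: T z (e i)).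
  apply: Ck_sum => // i; apply: Ck_scale => //.
  by apply: Ck_linear_comp => //; [exact: (ll i).1|exact: (ll i).2].
apply: Ck_ext Cs => // z Bz.
by rewrite [in RHS](el (w z)) linear_sumZ//; exact: lT.
Qed.

(** The case T z = 'd f (u z) of the preceding lemma, which costs one
    derivative of f. *)
Lemma Ck_diff_app E F H k (A : set E) (B : set H) (f : E -> F) (u w : H -> E) :
  finite_coords E -> open B -> (forall z, B z -> A (u z)) ->
  Ck k.+1 A f -> Ck k B u -> Ck k B w -> Ck k B (fun z => 'd f (u z) (w z)).
Proof.
move=> fE oB BA [_ cf] Cu Cw.
apply: (@Ck_app _ _ _ _ _ (fun z => 'd f (u z))) => // [z _ a v v'|v].
  by rewrite linearP.
exact: (Ck_comp fE oB BA Cu (cf v)).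
Qed.

End CkCalculus.

(** * Smooth bump functions *)

Section Bump.
Context {R : realType}.

(** The classical flat function, together with its products by powers of 1/x:
    this family is closed under differentiation up to linear combination, so
    that one induction shows that all its members are smooth. *)
Definition flat (m : nat) (x : R) : R :=
  if 0 < x then x^-1 ^+ m * expR (- x^-1) else 0.

Lemma flat_le0 m x : x <= 0 -> flat m x = 0.
Proof. by rewrite /flat => x0; rewrite ltNge x0. Qed.

Lemma flat_ge0 m x : 0 <= flat m x.
Proof.
rewrite /flat; case: ifPn => // x0.
by rewrite mulr_ge0 ?expR_ge0// exprn_ge0// invr_ge0 ltW.
Qed.

(** The exponential series at 1/x dominates its term of degree m + 1.  Used for
    m + 1 in place of m, this makes the difference quotient of flat m at 0, which
    is flat m.+1, tend to 0. *)
Lemma flat_le m x : `|flat m x| <= (m.+1)`!%:R * `|x|.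
Proof.
rewrite ger0_norm ?flat_ge0// /flat; case: ifPn => x0; last first.
  by rewrite mulr_ge0.
have y0 : 0 < x^-1 by rewrite invr_gt0.
have := expR_ge1Dxn m (ltW y0).
rewrite (gtr0_norm x0) expRN ler_pdivrMr ?expR_gt0// => ge.
have {}ge : x^-1 ^+ m.+1 / m.+1`!%:R <= expR x^-1.
  by apply: le_trans ge; rewrite lerDr.
move: ge; rewrite ler_pdivrMr ?ltr0n ?fact_gt0// exprS => ge.
rewrite -(ler_pM2l y0) mulrA (le_trans ge)// mulrC mulrCA mulVf ?gt_eqF//.
by rewrite mulr1 mulrC.
Qed.

Lemma is_derive_flat_gt0 m (x : R) : 0 < x ->
  is_derive x 1 (flat m) (flat m.+2 x - m%:R * flat m.+1 x).
Proof.
move=> x0; have xn0 : x != 0 by rewrite gt_eqF.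
have i : is_derive x 1 (fun y : R => y^-1) (- x ^- 2).
  apply: DeriveDef; first by apply: derivableV => //; exact: derivable_id.
  by rewrite deriveV// derive_id [LHS]mulr1.
have p : is_derive x 1 (fun y : R => y^-1 ^+ m)
    ((m%:R * x^-1 ^+ m.-1) *: - x ^- 2).
  by have := @is_deriveX _ _ _ m _ _ _ i; rewrite exprfctE.
have e : is_derive x 1 (expR \o (- (fun y : R => y^-1)))
  (expR (- x^-1) * - - x ^- 2).
  by apply: is_derive1_comp.
have pe := is_deriveM p e.
apply: (@near_eq_is_derive _ _ _
  ((fun y : R => y^-1 ^+ m) * (expR \o (- (fun y : R => y^-1))))).
  near=> y; rewrite /flat ifT; last by near: y; exact: lt_nbhsr.
  by [].
apply: (is_derive_eq pe); rewrite /flat x0 /= !fctE /=.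
rewrite /GRing.scale /= -exprVn; set y := x^-1; set E := expR _.
by case: m {p pe} => [|m] /=; rewrite ?exprS; ring.
Unshelve. all: by end_near. Qed.

Lemma is_derive_flat m (x : R) :
  is_derive x 1 (flat m) (flat m.+2 x - m%:R * flat m.+1 x).
Proof.
have [x0|x0|<-] := ltgtP 0 x; first exact: is_derive_flat_gt0.
  rewrite !flat_le0 ?(ltW x0)// mulr0 subr0.
  apply: (@near_eq_is_derive _ _ _ (cst (0 : R))).
  near=> y; rewrite flat_le0// ltW//.
  by near: y; exact: lt_nbhsl.
rewrite !(flat_le0 _ (lexx 0)) mulr0 subr0.
have l : h^-1 *: ((flat m \o shift 0) (h *: 1) - flat m 0) @[h --> 0^'] --> (0 : R).
  apply/cvgr0Pnorm_le => e e0; near=> h.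
  rewrite /= addr0 [X in flat m X]mulr1 (flat_le0 _ (lexx 0)) subr0.
  have -> : h^-1 *: flat m h = flat m.+1 h.
    by rewrite /flat; case: ifP => _; rewrite ?scaler0// /GRing.scale/= exprS mulrA.
  apply: le_trans (flat_le _ _) _.
  rewrite mulrC -ler_pdivlMr ?ltr0n ?fact_gt0//; near: h.
  exists (e / (m.+2)`!%:R) => /=; first by rewrite divr_gt0// ltr0n fact_gt0.
  by move=> h /=; rewrite sub0r normrN => /ltW.
by apply: DeriveDef; [apply/cvg_ex; exists 0|exact: (cvg_lim _ l)].
Unshelve. all: by end_near. Qed.

Lemma Ck_flat k m (A : set R) : open A -> Ck k A (flat m).
Proof.
move=> oA; elim: k m => [|k IH] m.
  move=> x _; apply/differentiable_continuous/derivable1_diffP.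
  by have [] := is_derive_flat m x.
have df x : differentiable (flat m) x.
  by apply/derivable1_diffP; have [] := is_derive_flat m x.
split=> // v.
have -> : (fun x => 'd (flat m) x v) =
    (fun x => v *: (flat m.+2 x + - m%:R *: flat m.+1 x)).
  apply/funext => x; rewrite diff1E// derive1E.
  by have [_ ->] := is_derive_flat m x; rewrite [- _ *: _]mulNr.
apply: Ck_scale => //; first exact: Ck_cst.
by apply: Ck_add => //; apply: Ck_scale => //; exact: Ck_cst.
Qed.

Lemma flat_mono x y : 0 < x -> x <= y -> flat 0 x <= flat 0 y.
Proof.
move=> x0 xy; have y0 := lt_le_trans x0 xy.
by rewrite /flat x0 y0 !expr0 !mul1r ler_expR lerN2 lef_pV2.
Qed.

(** For s >= 1 the inner value flat 0 (1 - s) vanishes, and for s <= 0 it is at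
    least flat 0 1, which makes the outer argument nonpositive: nesting flat
    yields a smooth step without any division by a nonconstant function. *)
Definition step (s : R) : R :=
  (flat 0 (flat 0 1))^-1 *: flat 0 (flat 0 1 - flat 0 (1 - s)).

Lemma flat01_gt0 : 0 < flat 0 1.
Proof. by rewrite /flat ltr01 mulr_gt0// expR_gt0. Qed.

Lemma step_ge1 s : 1 <= s -> step s = 1.
Proof.
move=> s1; rewrite /step [flat 0 (1 - s)]/flat ltNge subr_le0 s1 /= subr0.
by rewrite [LHS]mulVf// /flat flat01_gt0 mulf_neq0// gt_eqF ?expR_gt0.
Qed.

Lemma step_le0 s : s <= 0 -> step s = 0.
Proof.
move=> s0; rewrite /step [X in _ *: X]/flat ltNge subr_le0 flat_mono//=.
  by rewrite scaler0.
by rewrite lerDl oppr_ge0.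
Qed.

Lemma Ck_step k : Ck k setT step.
Proof.
apply: Ck_scale; [exact: openT|exact: Ck_cst|].
have C1 : Ck k setT (fun s : R => flat 0 (- s + 1)).
  apply: (@Ck_affine_comp _ _ _ _ _ setT (flat 0) -%R 1) => //.
  - by move=> a u v; rewrite opprD scalerN.
  - exact: opp_continuous.
  - exact: openT.
  - by apply: Ck_flat; exact: openT.
have C2 : Ck k setT (fun s : R => flat 0 1 + (-1) *: flat 0 (- s + 1)).
  by apply: Ck_add; [exact: openT|exact: Ck_cst|apply: Ck_scale; [exact: openT|exact: Ck_cst|]].
have C3 : Ck k setT (flat 0) by apply: Ck_flat; exact: openT.
have := Ck_comp finite_coords_real openT (fun _ _ => Logic.I) C2 C3.
apply: Ck_ext; first exact: openT.
by move=> s _; rewrite scaleN1r [- s + 1]addrC.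
Qed.

(** The smooth step applied to 2 - 2 |x - x0|^2 / r^2 for the Euclidean norm: the
    argument exceeds 1 near x0 and is nonpositive outside the Euclidean ball of
    radius r, which is contained in the ball for the maximum norm. *)
Lemma bump m (x0 : 'rV[R]_m) (r : R) : 0 < r -> exists chi : 'rV[R]_m -> R,
  [/\ smooth_on setT chi, \forall x \near x0, chi x = 1 &
      forall x, chi x != 0 -> `|x - x0| <= r].
Proof.
move=> r0.
pose q (x : 'rV[R]_m) := 2 + (- (2 / r ^+ 2)) *: \sum_i (x 0 i - x0 0 i) *: (x 0 i - x0 0 i).
have Cq k : Ck k setT q.
  apply: Ck_add; [exact: openT|exact: Ck_cst|].
  apply: Ck_scale; [exact: openT|exact: Ck_cst|].
  have Cc i : Ck k setT (fun x : 'rV[R]_m => x 0 i - x0 0 i).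
    apply: Ck_add; [exact: openT| |exact: (Ck_cst _ _ (- x0 0 i))].
    by apply: Ck_linear => [a u v|]; [rewrite !mxE|exact: coord_continuous].
  apply: (@Ck_sum _ _ _ _ _ _ (fun i (x : 'rV[R]_m) => (x 0 i - x0 0 i) *: (x 0 i - x0 0 i))) => [|i].
    exact: openT.
  by apply: Ck_scale => //; exact: openT.
exists (fun x => step (q x)); split=> [k||x].
- exact: (Ck_comp finite_coords_real openT (fun _ _ => Logic.I) (Cq k) (Ck_step k)).
- have cq : {for x0, continuous q} by apply: (Cq 0%N); rewrite inE.
  have q0 : 1 < q x0.
    rewrite /q big1 ?scaler0 ?addr0 ?ltr1n// => i _.
    by rewrite subrr scaler0.
  near=> x; apply/step_ge1/ltW; near: x.
  by have := cq _ (lt_nbhsr q0); rewrite /nbhs.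
- have [q0|q0 _] := leP (q x) 0; first by rewrite step_le0// eqxx.
  have {q0} : \sum_i (x 0 i - x0 0 i) ^+ 2 < r ^+ 2.
    move: q0; rewrite /q.
    rewrite (eq_bigr (fun i => (x 0 i - x0 0 i) ^+ 2)); last by move=> i _; rewrite expr2.
    set S := \sum_i _; rewrite scaleNr subr_gt0 [_ *: _]mulrAC.
    by rewrite ltr_pdivrMr ?exprn_gt0// ltr_pM2l.
  move=> sr; rewrite [leLHS]/Num.norm /= mx_normrE.
  apply/bigmax_leP; split=> [|[i j] _ /=]; first exact: ltW.
  rewrite !mxE (ord1 i) -(@ler_pXn2r _ 2)// ?nnegrE ?(ltW r0)//.
  rewrite real_normK ?num_real//; apply: le_trans (ltW sr).
  rewrite (bigD1 j)//= lerDl; apply: sumr_ge0 => l _; exact: sqr_ge0.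
Unshelve. all: by end_near. Qed.

End Bump.

(** * Changes of charts and extension of vectors to smooth fields *)

Section ChartCalculus.
Context {R : realType} {E : normedModType R} (M : manifold E).
Hypothesis coordsE : finite_coords E.
Implicit Types (c d e : chart M E) (p : M) (X : vfield M).

Lemma open_setI_preimage (S T : topologicalType) (f : S -> T) (A : set S)
    (B : set T) :
  open A -> open B -> {in A, continuous f} -> open (A `&` f @^-1` B).
Proof.
move=> oA oB cf; rewrite openE => x [Ax Bfx]; apply: filterI.
  exact: open_nbhs_nbhs.
by apply: cf; [rewrite inE|exact: open_nbhs_nbhs].
Qed.

Lemma overlap_cmap c d p : cdom c p -> cdom d p -> overlap c d (c p).
Proof. by move=> cp dp; split; [exact: cmap_cod|rewrite /= cmapK]. Qed.

Lemma transition_cmap c d p : cdom c p -> transition c d (c p) = d p.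
Proof. by move=> cp; rewrite /transition /= cmapK. Qed.

Lemma differentiable_transition c d p : atlas c -> atlas d ->
  cdom c p -> cdom d p -> differentiable (transition c d) (c p).
Proof.
move=> ac ad cp dp; have [D _] := atlas_smooth ac ad 1.
exact/D/overlap_cmap.
Qed.

Lemma diff_transition_comp c d e p v : atlas c -> atlas d -> atlas e ->
  cdom c p -> cdom d p -> cdom e p ->
  'd (transition d e) (d p) ('d (transition c d) (c p) v) =
  'd (transition c e) (c p) v.
Proof.
move=> ac ad ae cp dp ep.
have D1 := differentiable_transition ac ad cp dp.
have D2 : differentiable (transition d e) (transition c d (c p)).
  by rewrite transition_cmap//; exact: differentiable_transition.
have D12 := differentiable_comp D1 D2.
have eq12 : \forall x \near c p, (transition d e \o transition c d) x =
    transition c e x.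
  apply: filterS (open_nbhs_nbhs (conj (@overlap_open _ _ _ c d)
    (overlap_cmap cp dp))) => x [cx dx].
  by rewrite /transition /= cmapK.
have [_ ->] := near_eq_diff eq12 D12.
by rewrite (diff_comp D1 D2) /= transition_cmap.
Qed.

Lemma diff_transition_id c p v : atlas c -> cdom c p ->
  'd (transition c c) (c p) v = v.
Proof.
move=> ac cp.
have eqid : \forall x \near c p, id x = transition c c x.
  apply: filterS (open_nbhs_nbhs (conj (ccod_open c) (cmap_cod cp))) => x cx.
  by rewrite /transition /= cinvK.
have cid : continuous (@id E) by move=> x; exact: cvg_id.
have [di Di] := @diff_linear _ _ _ (@id E) (c p) (fun _ _ _ => erefl) cid.
by have [_ ->] := near_eq_diff eqid di; rewrite Di.
Qed.

(** Inverse of tcoord c p. *)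
Definition tvec c p : E -> E := 'd (transition c (chart_at p)) (c p).

Lemma tvecK c p v : atlas c -> cdom c p -> tcoord c p (tvec c p v) = v.
Proof.
move=> ac cp; have ? := chart_at_dom p; have ? := @chart_at_atlas _ _ M p.
by rewrite /tcoord /tvec diff_transition_comp// diff_transition_id.
Qed.

Lemma tcoordK c p v : atlas c -> cdom c p -> tvec c p (tcoord c p v) = v.
Proof.
move=> ac cp; have ? := chart_at_dom p; have ? := @chart_at_atlas _ _ M p.
by rewrite /tcoord /tvec diff_transition_comp// diff_transition_id.
Qed.

Lemma tcoord_chart_at p v : tcoord (chart_at p) p v = v.
Proof.
have ? := chart_at_dom p; have ? := @chart_at_atlas _ _ M p.
by rewrite /tcoord diff_transition_id.
Qed.

Lemma vlocal_cmap c X p : cdom c p -> vlocal c X (c p) = tcoord c p (X p).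
Proof. by move=> cp; rewrite /vlocal cmapK. Qed.

Lemma vlocal_chart_at X p : vlocal (chart_at p) X (chart_at p p) = X p.
Proof. by rewrite vlocal_cmap ?tcoord_chart_at//; exact: chart_at_dom. Qed.

Lemma vlocal_transition c d X x : atlas c -> atlas d -> overlap c d x ->
  'd (transition c d) x (vlocal c X x) = vlocal d X (transition c d x).
Proof.
move=> ac ad [cx dx]; pose p := cinv c x.
have cp : cdom c p by exact: cinv_dom.
have xp : x = c p by rewrite /p cinvK.
rewrite xp transition_cmap// !vlocal_cmap//.
by rewrite diff_transition_comp//; [exact: chart_at_atlas|exact: chart_at_dom].
Qed.

(** The components in another chart arise by composing with the transition map
    and applying the differential of its inverse, both of which are smooth. *)
Lemma smooth_vfield_local X :
  (forall p, exists c (B : set E), [/\ atlas c, cdom c p, open B, B (c p) &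
    B `<=` ccod c /\ forall k, Ck k B (vlocal c X)]) ->
  smooth_vfield X.
Proof.
move=> locX d ad k; apply: Ck_local => x dx.
have [c [B [ac cp oB Bp [Bc CX]]]] := locX (cinv d x).
have oO := @overlap_open _ _ _ d c.
have Ct j : Ck j (overlap d c) (transition d c) := atlas_smooth ad ac j.
have oB' : open (overlap d c `&` transition d c @^-1` B).
  by apply: open_setI_preimage => //; exact: (Ct 0%N).
exists (overlap d c `&` transition d c @^-1` B); split.
  split; first by split.
  by rewrite /preimage /= /transition /=.
have BO z : (overlap d c `&` transition d c @^-1` B) z ->
    overlap c d (transition d c z).
  move=> [[dz cz] Bz]; split; first exact: Bc.
  by rewrite /preimage /= /transition /= cmapK//; exact: cinv_dom.
have CtB j : Ck j (overlap d c `&` transition d c @^-1` B) (transition d c).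
  by apply: CkS (Ct j) => z [].
have CwB : Ck k (overlap d c `&` transition d c @^-1` B)
    (fun z => vlocal c X (transition d c z)).
  by apply: (Ck_comp coordsE oB' _ (CtB k) (CX k)) => z [].
have Cd := Ck_diff_app coordsE oB' BO (atlas_smooth ac ad k.+1) (CtB k) CwB.
apply: Ck_ext Cd => // z Bz; rewrite vlocal_transition//; last exact: BO.
case: Bz => -[dz cz] _.
by congr vlocal; rewrite /transition /= cmapK// cinvK.
Qed.

End ChartCalculus.

Section Extension.
Context {R : realType} {d : nat} (M : manifold 'rV[R]_d).
Let E := 'rV[R]_d.

(** Bump functions extend a vector given at a point, with constant components
    in a chart near that point, to a global smooth field; the extension by zero
    outside the chart is smooth since compact sets of M are closed. *)
Lemma extend_vfield (c : chart M E) x0 (v : E) : atlas c -> ccod c x0 ->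
  exists X : vfield M, smooth_vfield X /\ \forall x \near x0, vlocal c X x = v.
Proof.
move=> ac cx0.
have /nbhs_ballP[e /= e0 eA] := open_nbhs_nbhs (conj (ccod_open c) cx0).
pose r := e / 2; have r0 : 0 < r by rewrite divr_gt0.
have rA x : `|x - x0| <= r -> ccod c x.
  move=> xr; apply: eA; rewrite -ball_normE /= distrC.
  by apply: le_lt_trans xr _; rewrite /r ltr_pdivrMr// ltr_pMr// ltr1n.
have [chi [Cchi chi1 chi0]] := bump x0 r0.
pose X : vfield M := fun p =>
  if p \in cdom c then chi (c p) *: tvec c p v else 0.
have XE x : ccod c x -> vlocal c X x = chi x *: v.
  move=> cx; have cp := cinv_dom cx.
  rewrite /vlocal /X mem_set// /tcoord linearZ /= -/(tcoord c (cinv c x) _).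
  by rewrite tvecK// cinvK.
exists X; split; last first.
  have cn : \forall x \near x0, ccod c x.
    exact: (open_nbhs_nbhs (conj (ccod_open c) cx0)).
  by apply: filterS2 cn chi1 => x cx x1; rewrite XE// x1 scale1r.
pose K := cinv c @` [set x | `|x - x0| <= r].
have closedK : closed K.
  apply: compact_closed; first exact: manifold_hausdorff.
  apply: continuous_compact.
    apply: continuous_in_subspaceT => x; rewrite inE => /rA cx.
    by apply: cinv_cont; rewrite inE.
  apply: bounded_closed_compact.
    exists (r + `|x0|); split; first exact: num_real.
    move=> y ry x /= xr; apply: ltW; apply: le_lt_trans ry.
    by rewrite -(subrK x0 x) (le_trans (ler_normD _ _))// lerD2r.
  rewrite (_ : [set _ | _] = closed_ball x0 r); first exact: closed_ball_closed.
  by rewrite closed_ballE//; apply/seteqP; split=> x; rewrite /closed_ball_ /= distrC.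
have X0 p : ~ K p -> X p = 0.
  move=> nK; rewrite /X; case: ifPn => // /set_mem cp.
  have [->|/chi0 cr] := eqVneq (chi (c p)) 0; first by rewrite scale0r.
  by case: nK; exists (c p) => //; rewrite cmapK.
apply: smooth_vfield_local; first exact: finite_coords_rV.
move=> p; have [cp|ncp] := pselect (cdom c p).
  exists c, (ccod c); split=> //; [exact: ccod_open|exact: cmap_cod|].
  split=> // k; apply: Ck_ext (ccod_open c) _ _ => [x cx|].
    by rewrite XE.
  apply: Ck_scale; [exact: ccod_open|exact: CkS (Cchi k)|exact: Ck_cst].
pose c' := chart_at p.
have oB : open (ccod c' `&` cinv c' @^-1` ~` K).
  apply: open_setI_preimage; [exact: ccod_open|exact: closed_openC|].
  exact: cinv_cont.
exists c', (ccod c' `&` cinv c' @^-1` ~` K); split=> //.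
- exact: chart_at_atlas.
- exact: chart_at_dom.
- split; first exact: cmap_cod (chart_at_dom p).
  rewrite /preimage /= cmapK; last exact: chart_at_dom.
  by move=> [x /rA cx xp]; apply: ncp; rewrite -xp; exact: cinv_dom.
- split=> [x []//|k]; apply: Ck_ext (oB) _ (Ck_cst _ _ 0) => x [_ nK].
  by rewrite /vlocal X0// /tcoord linear0.
Qed.

(** Identities assumed for smooth fields thus hold for all tangent vectors. *)
Lemma extend_vector (p : M) (v : E) :
  exists2 X : vfield M, smooth_vfield X & X p = v.
Proof.
have [X [sX Xv]] := @extend_vfield (chart_at p) (chart_at p p) v
  (@chart_at_atlas _ _ M p) (cmap_cod (chart_at_dom p)).
by exists X => //; rewrite -(nbhs_singleton Xv) vlocal_chart_at.
Qed.

End Extension.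

(** * Components of smooth tensor fields, derivatives of functions *)

Section LocalTensors.
Context {R : realType} {d : nat} (M : manifold 'rV[R]_d).
Let E := 'rV[R]_d.
Implicit Types (c : chart M E) (p : M) (X Y : vfield M).

(** A tensor field that is smooth when tested on global smooth fields has smooth
    components: near each point some global field has constant components. *)
Lemma Ck_components (F : normedModType R) (T : E -> E -> F) c k : atlas c ->
  (forall X, smooth_vfield X -> Ck k (ccod c) (fun x => T x (vlocal c X x))) ->
  forall u, Ck k (ccod c) (T^~ u).
Proof.
move=> ac CT u; apply: Ck_local => x0 cx0.
have [X [sX]] := extend_vfield u ac cx0.
rewrite /prop_near1 nbhsE => -[B [oB Bx0] BX].
have oBc : open (B `&` ccod c) by apply: openI => //; exact: ccod_open.
exists (B `&` ccod c); split=> //.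
apply: Ck_ext oBc _ (CkS _ (CT X sX)) => [x [Bx _]|x []//].
by rewrite (BX x Bx).
Qed.

Definition endo_local (phi : M -> E -> E) c (x u : E) : E :=
  tcoord c (cinv c x) (phi (cinv c x) (tvec c (cinv c x) u)).

Definition form_local (eta : M -> E -> R) c (x u : E) : R :=
  eta (cinv c x) (tvec c (cinv c x) u).

Definition metric_local (g : M -> E -> E -> R) c (x u v : E) : R :=
  g (cinv c x) (tvec c (cinv c x) u) (tvec c (cinv c x) v).

Lemma tvec_vlocal c X x : atlas c -> ccod c x ->
  tvec c (cinv c x) (vlocal c X x) = X (cinv c x).
Proof. by move=> ac cx; rewrite tcoordK//; exact: cinv_dom. Qed.

Lemma Ck_endo_local phi c k u : is_endo_field phi -> atlas c ->
  Ck k (ccod c) (fun x => endo_local phi c x u).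
Proof.
move=> ephi ac; apply: (@Ck_components _ (endo_local phi c)) => // X sX.
apply: Ck_ext (ccod_open c) _ (endo_smooth ephi sX ac k) => x cx.
by rewrite /endo_local tvec_vlocal.
Qed.

Lemma Ck_form_local eta c k u : is_one_form eta -> atlas c ->
  Ck k (ccod c) (fun x => form_local eta c x u).
Proof.
move=> feta ac; apply: (@Ck_components _ (form_local eta c)) => // X sX.
apply: Ck_ext (ccod_open c) _ (form_smooth feta sX ac k) => x cx.
by rewrite /form_local tvec_vlocal.
Qed.

Lemma Ck_metric_local g c k u v : is_riemannian_metric g -> atlas c ->
  Ck k (ccod c) (fun x => metric_local g c x u v).
Proof.
move=> rg ac.
apply: (@Ck_components _ (fun x u => metric_local g c x u v)) => // X sX.
apply: (@Ck_components _ (fun x => metric_local g c x (vlocal c X x))) => // Y sY.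
apply: Ck_ext (ccod_open c) _ (metric_smooth rg sX sY ac k) => x cx.
by rewrite /metric_local !tvec_vlocal.
Qed.

Lemma linear_tvec c p : linear (tvec c p).
Proof. by move=> a u v; exact: linearP. Qed.

Lemma linear_tcoord c p : linear (tcoord c p).
Proof. by move=> a u v; exact: linearP. Qed.

Lemma linear_endo_local phi c x : is_endo_field phi ->
  linear (endo_local phi c x).
Proof.
move=> ephi a u v.
by rewrite /endo_local linear_tvec (endo_linear ephi) linear_tcoord.
Qed.

Lemma linear_form_local eta c x : is_one_form eta ->
  linear (form_local eta c x).
Proof.
by move=> feta a u v; rewrite /form_local linear_tvec (form_linear feta).
Qed.

Lemma metric_linear_l g p v : is_riemannian_metric g ->
  scalar (fun u => g p u v).
Proof.
move=> rg a u w.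
by rewrite ![g p _ v](Defs.metric_sym rg) (metric_linear rg).
Qed.

Lemma linear_metric_local_r g c x u : is_riemannian_metric g ->
  linear (metric_local g c x u).
Proof.
by move=> rg a v w; rewrite /metric_local linear_tvec (metric_linear rg).
Qed.

Lemma linear_metric_local_l g c x v : is_riemannian_metric g ->
  linear (fun u => metric_local g c x u v).
Proof.
by move=> rg a u w; rewrite /metric_local linear_tvec (metric_linear_l _ _ rg).
Qed.

End LocalTensors.

Section LieFun.
Context {R : realType} {E : normedModType R} (M : manifold E).
Implicit Types (X : vfield M) (f h : M -> R).

Lemma differentiable_smooth_fun f p : smooth_fun f ->
  differentiable (f \o cinv (chart_at p)) (chart_at p p).
Proof.
move=> sf; have [D _] := sf _ (@chart_at_atlas _ _ M p) 1.
exact/D/cmap_cod/chart_at_dom.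
Qed.

Lemma lie_funD X f h p : smooth_fun f -> smooth_fun h ->
  lie_fun X (fun q => f q + h q) p = lie_fun X f p + lie_fun X h p.
Proof.
move=> sf sh; have [_ D] := diff_addf (differentiable_smooth_fun p sf)
  (differentiable_smooth_fun p sh).
exact: (congr1 (@^~ (X p)) D).
Qed.

Lemma lie_funM X f h p : smooth_fun f -> smooth_fun h ->
  lie_fun X (fun q => f q * h q) p = lie_fun X f p * h p + f p * lie_fun X h p.
Proof.
move=> sf sh; have [_ D] := diff_scale (differentiable_smooth_fun p sf)
  (differentiable_smooth_fun p sh).
rewrite [LHS](congr1 (@^~ (X p)) D) /= cmapK//; exact: chart_at_dom.
Qed.

Lemma smooth_fun_cst (a : R) : smooth_fun (fun _ : M => a).
Proof. by move=> c _ k; exact: Ck_cst. Qed.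

Lemma smooth_funD f h : smooth_fun f -> smooth_fun h ->
  smooth_fun (fun q => f q + h q).
Proof.
move=> sf sh c ac k.
by apply: Ck_add; [exact: ccod_open|exact: sf|exact: sh].
Qed.

Lemma smooth_funM f h : smooth_fun f -> smooth_fun h ->
  smooth_fun (fun q => f q * h q).
Proof.
move=> sf sh c ac k.
by apply: Ck_scale; [exact: ccod_open|exact: sf|exact: sh].
Qed.

Lemma lie_fun_cst X (a : R) p : lie_fun X (fun=> a) p = 0.
Proof.
rewrite /lie_fun (_ : _ \o _ = cst a); last exact/funext.
by rewrite diff_cst.
Qed.

Lemma smooth_vfieldD X Y : smooth_vfield X -> smooth_vfield Y ->
  smooth_vfield (X \+ Y).
Proof.
move=> sX sY c ac k; have oc := ccod_open c.
apply: Ck_ext (Ck_add oc (sX c ac k) (sY c ac k)) => // x _.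
by rewrite /vlocal /tcoord linearD.
Qed.

Lemma smooth_vfieldZ f X : smooth_fun f -> smooth_vfield X ->
  smooth_vfield (fun q => f q *: X q).
Proof.
move=> sf sX c ac k; have oc := ccod_open c.
apply: Ck_ext (Ck_scale oc (sf c ac k) (sX c ac k)) => // x _.
by rewrite /vlocal /tcoord linearZ.
Qed.

End LieFun.

(** * Differentials on a product with the line *)

Section ProductCalculus.
Context {R : realType}.
Implicit Types E F G : normedModType R.

Lemma linear_pair0 E : linear (fun x : E => (x, 0 : R)).
Proof. by move=> a x y; congr (_, _) => /=; rewrite [_ *: 0]scaler0 addr0. Qed.

Lemma continuous_pair0 E : continuous (fun x : E => (x, 0 : R)).
Proof.
move=> x; have cf : {for x, continuous (@id E)} by exact: cvg_id.
have cg : {for x, continuous (cst 0 : E -> R)} by exact: cvg_cst.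
exact: (cvg_pair cf cg).
Qed.

Lemma linear_0pair E : linear (fun s : R => (0 : E, s)).
Proof. by move=> a x y; congr (_, _) => /=; rewrite scaler0 addr0. Qed.

Lemma continuous_0pair E : continuous (fun s : R => (0 : E, s)).
Proof.
move=> x; have cf : {for x, continuous (cst 0 : R -> E)} by exact: cvg_cst.
have cg : {for x, continuous (@id R)} by exact: cvg_id.
exact: (cvg_pair cf cg).
Qed.

Lemma pair0D E (x : E) (t : R) : (x, 0) + (0, t) = (x, t).
Proof. by congr (_, _); rewrite ?addr0 ?add0r. Qed.

Lemma pair0Dr E (x : E) (t : R) : (0, t) + (x, 0) = (x, t).
Proof. by rewrite addrC pair0D. Qed.

Lemma Ck_slice E F k (A : set E) (f : E * R -> F) t : open A ->
  Ck k (A `*` setT) f -> Ck k A (fun x => f (x, t)).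
Proof.
move=> oA Cf; have oAT : open (A `*` [set: R]) by exact: open_setX openT.
have := @Ck_affine_comp _ _ _ _ _ _ f (fun x => (x, 0)) (0, t)
  (@linear_pair0 E) (@continuous_pair0 E) oAT Cf.
rewrite (_ : [set x | _] = A); last first.
  by apply/seteqP; split=> x; rewrite /mkset pair0D => //= -[].
move=> C; apply: Ck_ext C => // x _; by rewrite pair0D.
Qed.

(** Restriction to an axis through (x, t) is an affine substitution, and
    w = (w.1, 0) + w.2 (0, 1). *)
Lemma diff_partial E F (f : E * R -> F) x t : differentiable f (x, t) ->
  [/\ differentiable (fun y => f (y, t)) x, differentiable (fun s => f (x, s)) t &
  forall w, 'd f (x, t) w =
    'd (fun y => f (y, t)) x w.1 + w.2 *: 'd (fun s => f (x, s)) t 1].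
Proof.
move=> df.
have df1 : differentiable f ((x, 0) + (0, t)) by rewrite pair0D.
have df2 : differentiable f ((0, t) + (x, 0)) by rewrite pair0Dr.
have [d1 D1] := diff_affine_comp (@linear_pair0 E) (@continuous_pair0 E) df1.
have [d2 D2] := diff_affine_comp (@linear_0pair E) (@continuous_0pair E) df2.
have e1 : (fun y => f ((y, 0) + (0, t))) = fun y => f (y, t).
  by apply/funext => y; rewrite pair0D.
have e2 : (fun s => f ((0, s) + (x, 0))) = fun s => f (x, s).
  by apply/funext => s; rewrite pair0Dr.
rewrite e1 pair0D in d1 D1; rewrite e2 pair0Dr in d2 D2.
split=> // w.
rewrite D1 D2 -linearZ -linearD; congr ('d f _ _).
by case: w => u a; congr (_, _) => /=; rewrite ?scaler0 ?addr0 ?add0r// [_ *: _]mulr1.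
Qed.

Lemma diff_comp_fst E F G (f : E -> F) (z : E * G) : differentiable f (z.1) ->
  differentiable (fun y : E * G => f y.1) z /\
  'd (fun y : E * G => f y.1) z = (fun w => 'd f (z.1) w.1) :> (E * G -> F).
Proof.
move=> df; have [d1 D1] := diff_fst z; split; first exact: differentiable_comp.
by rewrite (diff_comp d1 df) D1.
Qed.

(** Bilinear maps on a finite-dimensional space are continuous, so that the
    product rule applies. *)
Lemma diff_bilinear E F (B : F -> F -> R) (f h : E -> F) x :
  finite_coords F -> (forall u, linear (B u)) -> (forall v, linear (B^~ v)) ->
  differentiable f x -> differentiable h x ->
  differentiable (fun y => B (f y) (h y)) x /\
  forall v, 'd (fun y => B (f y) (h y)) x v =
    B ('d f x v) (h x) + B (f x) ('d h x v).
Proof.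
move=> fF lr ll df dh; pose b : {bilinear F -> F -> R} :=
  HB.pack B (bilinear_isBilinear.Build R F F R _ _ B (ll, lr)).
have cb : continuous (fun p => b p.1 p.2).
  have [m [e [l [lel el]]]] := fF.
  have -> : (fun p => b p.1 p.2) = fun p => \sum_i l i p.1 *: B (e i) p.2.
    by apply/funext => p; rewrite /b /= {1}(el p.1) (linear_sumZ _ _ (ll p.2)).
  move=> p; apply: continuous_sumf => i.
  apply: cvgZ; last first.
    apply: continuous_comp; first exact: cvg_snd.
    exact: linear_continuous.
  by apply: continuous_comp; [exact: cvg_fst|exact: (lel i).2].
have dp : differentiable (fun y => (f y, h y)) x by exact: differentiable_pair.
have db := differentiable_bilin (f x, h x) cb.
split; first exact: (differentiable_comp dp db).
move=> v; have -> := congr1 (@^~ v) (diff_comp dp db).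
by rewrite /= (diff_bilin _ cb) diff_pair//= addrC.
Qed.

End ProductCalculus.

(** * Fields on M x R *)

Section LineProduct.
Context {R : realType} {d : nat} (M : manifold 'rV[R]_d).
Let E := 'rV[R]_d.
Implicit Types (c : chart M E) (p : M) (X : vfield M).
Implicit Types (U V W : vfield (line_product M)) (t : R).

Definition hor V t : vfield M := fun p => (V (p, t)).1.
Definition ver V t : M -> R := fun p => (V (p, t)).2.

Definition hor_local c V (z : E * R) : E := vlocal c (hor V z.2) z.1.
Definition ver_local c V (z : E * R) : R := ver V z.2 (cinv c z.1).

Definition dt_hor V p t : E := 'd (fun s => hor V s p) t 1.
Definition dt_ver V p t : R := 'd (fun s => ver V s p) t 1.

Lemma tcoord_line c p t w : atlas c -> cdom c p ->
  @tcoord _ _ (line_product M) (line_chart c) (p, t) w = (tcoord c p w.1, w.2).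
Proof.
move=> ac cp.
have D := differentiable_transition (@chart_at_atlas _ _ M p) ac
  (chart_at_dom p) cp.
have [d1 D1] := @diff_comp_fst _ _ _ R (transition (chart_at p) c)
  (chart_at p p, t) D.
have [d2 D2] := @diff_snd _ E R (chart_at p p, t).
have := diff_pair d1 d2; rewrite D1 D2 => e.
exact: (congr1 (@^~ w) e).
Qed.

Lemma vlocal_line c V (z : E * R) : atlas c -> ccod c z.1 ->
  @vlocal _ _ (line_product M) (line_chart c) V z = (hor_local c V z, ver_local c V z).
Proof.
by case: z => x t ac cx; rewrite /vlocal /= tcoord_line//; exact: cinv_dom.
Qed.

Lemma openXT c : open (ccod c `*` [set: R]).
Proof. by apply: open_setX; [exact: ccod_open|exact: openT]. Qed.

Lemma smooth_lineP V : smooth_vfield V <-> (forall c k, atlas c ->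
  Ck k (ccod c `*` setT) (hor_local c V) /\
  Ck k (ccod c `*` setT) (ver_local c V)).
Proof.
split=> [sV c k ac|sV _ [c ac <-] k].
  have CV : Ck k (ccod c `*` setT) (fun z => (hor_local c V z, ver_local c V z)).
    apply: Ck_ext (@openXT c) _ (sV (line_chart c) _ k) => [z [cz _]|].
      exact: vlocal_line.
    by exists c.
  split.
    by have := Ck_linear_comp (@openXT c) (@fst_is_linear _ E R) (@fst_cont _ E R) CV.
  by have := Ck_linear_comp (@openXT c) (@snd_is_linear _ E R) (@snd_cont _ E R) CV.
have [C1 C2] := sV c k ac.
apply: Ck_ext (@openXT c) _ (Ck_pair (@openXT c) C1 C2) => z [cz _].
by rewrite vlocal_line.
Qed.

Lemma smooth_hor V t : smooth_vfield V -> smooth_vfield (hor V t).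
Proof.
move=> /smooth_lineP sV c ac k; have [C _] := sV c k ac.
exact: (Ck_slice t (ccod_open c) C).
Qed.

Lemma smooth_ver V t : smooth_vfield V -> smooth_fun (ver V t).
Proof.
move=> /smooth_lineP sV c ac k; have [_ C] := sV c k ac.
exact: (Ck_slice t (ccod_open c) C).
Qed.

Definition lift X (f : M -> R) : vfield (line_product M) :=
  fun z => (X z.1, f z.1).

Lemma smooth_lift X f : smooth_vfield X -> smooth_fun f ->
  smooth_vfield (lift X f).
Proof.
move=> sX sf; apply/smooth_lineP => c k ac; split.
  exact: (Ck_fst R (ccod_open c) (sX c ac k)).
exact: (Ck_fst R (ccod_open c) (sf c ac k)).
Qed.

Lemma chart_at_XT p t : (ccod (chart_at p) `*` [set: R]) (chart_at p p, t).
Proof. by split=> //; exact: cmap_cod (chart_at_dom p). Qed.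

(** At the centre of the preferred chart of p, the components of V (., s) are
    those of V itself, so that the t-derivative may be taken in the tangent
    space at p. *)
Lemma diff_hor V p t : smooth_vfield V -> let x := chart_at p p in
  [/\ differentiable (hor_local (chart_at p) V) (x, t),
      differentiable (fun s => hor V s p) t &
      forall w, 'd (hor_local (chart_at p) V) (x, t) w =
        'd (vlocal (chart_at p) (hor V t)) x w.1 + w.2 *: dt_hor V p t].
Proof.
move=> /smooth_lineP sV x; have [[D _] _] := sV _ 1 (@chart_at_atlas _ _ M p).
have dV := D _ (chart_at_XT p t); have [_ d2 Dw] := diff_partial dV.
have e : (fun s => hor_local (chart_at p) V (x, s)) = (fun s => hor V s p).
  by apply/funext => s; rewrite /hor_local vlocal_chart_at.
by rewrite e in d2 Dw.
Qed.

Lemma diff_ver V p t : smooth_vfield V -> let x := chart_at p p in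
  [/\ differentiable (ver_local (chart_at p) V) (x, t),
      differentiable (fun s => ver V s p) t &
      forall w, 'd (ver_local (chart_at p) V) (x, t) w =
        'd (ver V t \o cinv (chart_at p)) x w.1 + w.2 * dt_ver V p t].
Proof.
move=> /smooth_lineP sV x; have [_ [D _]] := sV _ 1 (@chart_at_atlas _ _ M p).
have dV := D _ (chart_at_XT p t); have [_ d2 Dw] := diff_partial dV.
have e : (fun s => ver_local (chart_at p) V (x, s)) = (fun s => ver V s p).
  by apply/funext => s; rewrite /ver_local /= cmapK//; exact: chart_at_dom.
by rewrite e in d2 Dw.
Qed.

Lemma diff_vlocal_line V p t w : smooth_vfield V ->
  let c := chart_at p in
  'd (@vlocal _ _ (line_product M) (line_chart c) V) (c p, t) w =
    ('d (vlocal c (hor V t)) (c p) w.1 + w.2 *: dt_hor V p t,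
     'd (ver V t \o cinv c) (c p) w.1 + w.2 * dt_ver V p t).
Proof.
move=> sV c; have [dh _ Dh] := diff_hor p t sV; have [dv _ Dv] := diff_ver p t sV.
have near_eq : \forall z \near (c p, t),
    (fun z => (hor_local c V z, ver_local c V z)) z = @vlocal _ _ (line_product M) (line_chart c) V z.
  apply: filterS (open_nbhs_nbhs (conj (@openXT c) (chart_at_XT p t))).
  by move=> z [cz _]; rewrite vlocal_line//; exact: chart_at_atlas.
have [_ ->] := near_eq_diff near_eq (differentiable_pair dh dv).
by rewrite diff_pair// Dh Dv.
Qed.

Lemma lie_bracket_line U V p t : smooth_vfield U -> smooth_vfield V ->
  lie_bracket U V (p, t) =
  (lie_bracket (hor U t) (hor V t) p
     + (ver U t p *: dt_hor V p t - ver V t p *: dt_hor U p t),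
   (lie_fun (hor U t) (ver V t) p + ver U t p * dt_ver V p t)
     - (lie_fun (hor V t) (ver U t) p + ver V t p * dt_ver U p t)).
Proof.
move=> sU sV; rewrite /lie_bracket.
rewrite [X in X - _](diff_vlocal_line p t (U (p, t)) sV).
rewrite [X in _ - X](diff_vlocal_line p t (V (p, t)) sU).
by congr (_, _) => /=; rewrite opprD addrACA.
Qed.

Lemma lie_fun_line U (f : line_product M -> R) p t :
  differentiable (f \o cinv (line_chart (chart_at p))) (chart_at p p, t) ->
  lie_fun U f (p, t) = lie_fun (hor U t) (fun q => f (q, t)) p
    + ver U t p * 'd (fun s => f (p, s)) t 1.
Proof.
move=> df; have [_ _ /(_ (U (p, t)))] := diff_partial df.
have -> : (fun s => (f \o cinv (line_chart (chart_at p))) (chart_at p p, s)) =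
    (fun s => f (p, s)).
  apply/funext => s; rewrite /= /line_inv /= cmapK//; exact: chart_at_dom.
exact.
Qed.

End LineProduct.

(** * The Levi-Civita connection of the cone *)

Lemma diff_expRM (R : realType) (a t : R) :
  differentiable (fun s => expR (a * s)) t /\
  'd (fun s => expR (a * s)) t 1 = a * expR (a * t).
Proof.
have ll : linear (fun s : R => a * s).
  by move=> b x y; rewrite mulrDr; congr (_ + _); exact: mulrCA.
have [dl Dl] := diff_linear t ll (linear_continuous finite_coords_real ll).
have dE : differentiable (@expR R) (a * t).
  by apply/derivable1_diffP; exact: derivable_expR.
split; first exact: (differentiable_comp dl dE).
have -> := congr1 (@^~ 1) (diff_comp dl dE).
have -> : ('d (@expR R) (a * t) \o 'd (fun s => a * s) t) 1 =
    'd (@expR R) (a * t) (a * 1).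
  exact: (congr1 (fun f : R -> R => 'd (@expR R) (a * t) (f 1)) Dl).
rewrite mulr1; have -> := congr1 (@^~ a) (diff1E dE).
by rewrite derive1E (@derive_val _ _ _ _ _ _ _ (is_derive_expR (a * t))).
Qed.

Section MetricAlgebra.
Context {R : realType} {d : nat} (M : manifold 'rV[R]_d).
Variables (g : M -> 'rV[R]_d -> 'rV[R]_d -> R) (rg : is_riemannian_metric g).
Implicit Types (p : M) (u v w : 'rV[R]_d) (a : R).

Lemma metricDr p u v w : g p u (v + w) = g p u v + g p u w.
Proof. by have := metric_linear rg p u 1 v w; rewrite scale1r mul1r. Qed.

Lemma metric0r p u : g p u 0 = 0.
Proof. by apply: (addrI (g p u 0)); rewrite -metricDr !addr0. Qed.

Lemma metricZr p a u v : g p u (a *: v) = a * g p u v.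
Proof. by have := metric_linear rg p u a v 0; rewrite addr0 metric0r addr0. Qed.

Lemma metricNr p u v : g p u (- v) = - g p u v.
Proof. by rewrite -scaleN1r metricZr mulN1r. Qed.

Lemma metricDl p u v w : g p (v + w) u = g p v u + g p w u.
Proof. by rewrite ![g p _ u](Defs.metric_sym rg) metricDr. Qed.

Lemma metricZl p a u v : g p (a *: v) u = a * g p v u.
Proof. by rewrite ![g p _ u](Defs.metric_sym rg) metricZr. Qed.

Lemma metricNl p u v : g p (- v) u = - g p v u.
Proof. by rewrite ![g p _ u](Defs.metric_sym rg) metricNr. Qed.

Definition metricE := (metricDl, metricDr, metricZl, metricZr, metricNl, metricNr).

Lemma metric_eq0 p u : g p u u = 0 -> u = 0.
Proof.
by move=> gu; apply/eqP; apply: contraPT gu => /(metric_pos rg p) /gt_eqF/eqP.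
Qed.

End MetricAlgebra.

Section ConeConnection.
Context {R : realType} {d : nat} (M : manifold 'rV[R]_d).
Let E := 'rV[R]_d.
Variables (g : M -> E -> E -> R) (rg : is_riemannian_metric g).
Variables (nabla : vfield M -> vfield M -> vfield M)
  (lc : is_levi_civita g nabla).
Implicit Types (p : M) (X Y Z : vfield M).
Implicit Types (U V W : vfield (line_product M)) (t : R).

(** The effect on nabla + d/dt of the conformal factor exp(-2t): the gradient
    of -t is -d/dt, whence the terms without derivatives. *)
Definition cone_conn U V : vfield (line_product M) := fun z =>
  let p := z.1 in let t := z.2 in
  (nabla (hor U t) (hor V t) p + ver U t p *: dt_hor V p t
     - ver V t p *: hor U t p - ver U t p *: hor V t p,
   lie_fun (hor U t) (ver V t) p + ver U t p * dt_ver V p t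
     + g p (hor U t p) (hor V t p) - ver U t p * ver V t p).

Lemma cone_conn_torsion U V p t : smooth_vfield U -> smooth_vfield V ->
  cone_conn U V (p, t) - cone_conn V U (p, t) = lie_bracket U V (p, t).
Proof.
move=> sU sV; rewrite lie_bracket_line//.
rewrite -(lc_torsion_free lc) //; [|exact: smooth_hor..].
congr (_, _); rewrite /=.
  move: (nabla _ _ p) (nabla _ _ p) (dt_hor V p t) (dt_hor U p t) (hor V t p)
    (hor U t p) => n1 n2 dV dU v u.
  by apply/rowP => i; rewrite !mxE; ring.
rewrite (Defs.metric_sym rg p (hor V t p)).
move: (lie_fun _ _ p) (lie_fun _ _ p) (dt_ver V p t) (dt_ver U p t) (g p _ _)
  (ver U t p) (ver V t p) => lV lU dV dU m u v; ring.
Qed.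

Lemma Ck_metric_apply (c : chart M E) k (v w : E * R -> E) : atlas c ->
  Ck k (ccod c `*` setT) v -> Ck k (ccod c `*` setT) w ->
  Ck k (ccod c `*` setT) (fun z => metric_local g c z.1 (v z) (w z)).
Proof.
move=> ac Cv Cw; have oXT := @openXT _ _ M c; have fE := @finite_coords_rV R d.
have C1 u : Ck k (ccod c `*` setT) (fun z => metric_local g c z.1 (v z) u).
  apply: (Ck_app (T := fun z v => metric_local g c z.1 v u) fE oXT _ _ Cv).
    by move=> z _; exact: linear_metric_local_l.
  by move=> v0; exact: (Ck_fst R (ccod_open c) (Ck_metric_local k v0 u rg ac)).
apply: (Ck_app (T := fun z => metric_local g c z.1 (v z)) fE oXT _ C1 Cw).
by move=> z _; exact: linear_metric_local_r.
Qed.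

(** Needed for lie_fun of the inner product to be the genuine derivative: the
    compatibility of nablabar with the metric does not provide it. *)
Lemma differentiable_cone_inner V W p t :
  smooth_vfield V -> smooth_vfield W ->
  differentiable (inner (cone_metric g) V W \o cinv (line_chart (chart_at p)))
    (chart_at p p, t).
Proof.
move=> sV sW; pose c := chart_at p; have ac := @chart_at_atlas _ _ M p.
have oXT := @openXT _ _ M c.
have [CV cV] := (smooth_lineP V).1 sV c 1%N ac.
have [CW cW] := (smooth_lineP W).1 sW c 1%N ac.
pose h (z : E * R) := metric_local g c z.1 (hor_local c V z) (hor_local c W z)
  + ver_local c V z *: ver_local c W z.
have Ch : Ck 1 (ccod c `*` setT) h.
  exact: Ck_add oXT (Ck_metric_apply ac CV CW) (Ck_scale oXT cV cW).
have dh := Ch.1 _ (chart_at_XT p t).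
have [de _] := diff_expRM (- 2) t.
have d2 := (@diff_snd _ E R (c p, t)).1.
have [dp _] := diff_scale (differentiable_comp d2 de) dh.
have near_eq : \forall z \near (c p, t),
    (fun z : E * R => expR (- 2 * z.2) *: h z) z =
    (inner (cone_metric g) V W \o cinv (line_chart c)) z.
  apply: filterS (open_nbhs_nbhs (conj oXT (chart_at_XT p t))) => -[x s] [/= cx _].
  rewrite /h /inner /cone_metric /metric_local /hor_local /=.
  by rewrite !tvec_vlocal.
by have [] := near_eq_diff near_eq dp.
Qed.

Lemma cone_conn_metric U V W p t :
  smooth_vfield U -> smooth_vfield V -> smooth_vfield W ->
  lie_fun U (inner (cone_metric g) V W) (p, t) =
  cone_metric g (p, t) (cone_conn U V (p, t)) (W (p, t))
  + cone_metric g (p, t) (V (p, t)) (cone_conn U W (p, t)).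
Proof.
move=> sU sV sW; rewrite lie_fun_line; last exact: differentiable_cone_inner.
have [[sU1 sV1] sW1] := (smooth_hor t sU, smooth_hor t sV, smooth_hor t sW).
have [sV2 sW2] := (smooth_ver t sV, smooth_ver t sW).
have sg : smooth_fun (inner g (hor V t) (hor W t)) := metric_smooth rg sV1 sW1.
have -> : lie_fun (hor U t) (fun q => inner (cone_metric g) V W (q, t)) p =
    expR (- 2 * t) * (g p (nabla (hor U t) (hor V t) p) (hor W t p)
      + g p (hor V t p) (nabla (hor U t) (hor W t) p)
      + (lie_fun (hor U t) (ver V t) p * ver W t p
         + ver V t p * lie_fun (hor U t) (ver W t) p)).
  rewrite -(lc_metric lc)// -lie_funM// -lie_funD//; last exact: smooth_funM.
  have := @lie_funM _ _ M (hor U t) (fun=> expR (- 2 * t))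
    (fun q => inner g (hor V t) (hor W t) q + ver V t q * ver W t q) p
    (@smooth_fun_cst _ _ M _) (smooth_funD sg (smooth_funM sV2 sW2)).
  by rewrite lie_fun_cst mul0r add0r.
have -> : 'd (fun s => inner (cone_metric g) V W (p, s)) t 1 =
    - 2 * expR (- 2 * t) *
      (g p (hor V t p) (hor W t p) + ver V t p * ver W t p)
    + expR (- 2 * t) * (g p (dt_hor V p t) (hor W t p)
        + g p (hor V t p) (dt_hor W p t)
        + (dt_ver V p t * ver W t p + ver V t p * dt_ver W p t)).
  have [[_ dV1 _] [_ dW1 _]] := (diff_hor p t sV, diff_hor p t sW).
  have [[_ dV2 _] [_ dW2 _]] := (diff_ver p t sV, diff_ver p t sW).
  have [db Db] := @diff_bilinear _ R E (g p) _ _ t (finite_coords_rV _)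
    (metric_linear rg p) (fun v => metric_linear_l p v rg) dV1 dW1.
  have [dm Dm] := diff_scale dV2 dW2.
  have [da Da] := diff_addf db dm.
  have [de De] := diff_expRM (- 2) t.
  have [_ Ds] := diff_scale de da.
  rewrite [LHS](congr1 (@^~ 1) Ds) /= De Da Db Dm.
  by [].
rewrite /cone_metric /cone_conn /= -/(hor V t p) -/(hor W t p)
  -/(ver V t p) -/(ver W t p) !(metricE rg).
rewrite (Defs.metric_sym rg p (hor V t p) (hor U t p)).
move: (expR _) (nabla _ _ p) (nabla _ _ p) (dt_hor V p t) (dt_hor W p t)
  (hor U t p) (hor V t p) (hor W t p) (lie_fun _ _ p) (lie_fun _ _ p)
  => e nV nW dV dW u v w lV lW.
move: (ver U t p) (ver V t p) (ver W t p) (dt_ver V p t) (dt_ver W p t)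
  => a b c db dc; ring.
Qed.

Lemma cone_metricBl z u v w :
  cone_metric g z (u - v) w = cone_metric g z u w - cone_metric g z v w.
Proof. by rewrite /cone_metric /= !(metricE rg); ring. Qed.

Lemma cone_metric_sym z u v : cone_metric g z u v = cone_metric g z v u.
Proof. by rewrite /cone_metric (Defs.metric_sym rg) [u.2 * _]mulrC. Qed.

Lemma cone_metric_eq0 z u : cone_metric g z u u = 0 -> u = 0.
Proof.
move=> /eqP; rewrite mulf_eq0 gt_eqF ?expR_gt0//= => /eqP e.
have g0 : 0 <= g z.1 u.1 u.1.
  have [->|u0] := eqVneq u.1 0; first by rewrite (metric0r rg).
  exact/ltW/(metric_pos rg).
have s0 : 0 <= u.2 * u.2 by rewrite -expr2 sqr_ge0.
have /(metric_eq0 rg) u1 : g z.1 u.1 u.1 = 0 by lra.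
have /eqP : u.2 * u.2 = 0 by lra.
by rewrite mulf_eq0 orbb => /eqP u2; case: u u1 u2 {e g0 s0} => /= ? ? -> ->.
Qed.

Variables (nablabar : vfield (line_product M) -> vfield (line_product M) ->
  vfield (line_product M)) (lcbar : is_levi_civita (cone_metric g) nablabar).

(** Uniqueness of the Levi-Civita connection, at one point: the difference of
    two torsion-free metric connections is symmetric in its arguments and
    skew-symmetric for the metric, hence zero. *)
Lemma cone_connE U V p t : smooth_vfield U -> smooth_vfield V ->
  nablabar U V (p, t) = cone_conn U V (p, t).
Proof.
move=> sU sV; pose z : line_product M := (p, t).
pose D A B := nablabar A B z - cone_conn A B z.
have Dsym A B : smooth_vfield A -> smooth_vfield B -> D A B = D B A.
  move=> sA sB; have := lc_torsion_free lcbar sA sB z.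
  rewrite -(cone_conn_torsion p t sA sB) -/z /D.
  move: (nablabar A B z) (nablabar B A z) (cone_conn A B z) (cone_conn B A z).
  move=> a b a' b' /eqP; rewrite subr_eq => /eqP ->.
  by rewrite addrAC [a' - b' - a']addrAC subrr sub0r addrC.
pose T A B W := cone_metric g z (D A B) (W z).
have Tskew A B W : smooth_vfield A -> smooth_vfield B -> smooth_vfield W ->
    T A B W = - T A W B.
  move=> sA sB sW; have := lc_metric lcbar sA sB sW z.
  rewrite (cone_conn_metric p t sA sB sW) -/z /T /D !cone_metricBl.
  by rewrite ![cone_metric g z (B z) _]cone_metric_sym => e; lra.
have Tsym A B W : smooth_vfield A -> smooth_vfield B -> T A B W = T B A W.
  by move=> sA sB; rewrite /T Dsym.
have T0 W : smooth_vfield W -> T U V W = 0.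
  move=> sW.
  have e : T U V W = - T U V W.
    by rewrite {1}Tskew// Tsym// Tskew// Tsym// opprK Tskew// Tsym.
  lra.
have [X sX Xp] := extend_vector p (D U V).1.
have := T0 _ (smooth_lift sX (@smooth_fun_cst _ _ M (D U V).2)).
have -> : T U V (lift X (fun=> (D U V).2)) = cone_metric g z (D U V) (D U V).
  by rewrite /T; congr cone_metric; rewrite /lift Xp -surjective_pairing.
by move/cone_metric_eq0/subr0_eq.
Qed.

End ConeConnection.

(** * Almost contact metric structures *)

Section AlmostContact.
Context {R : realType} {d : nat} (M : manifold 'rV[R]_d).
Let E := 'rV[R]_d.
Variables (phi : M -> E -> E) (xi : vfield M) (eta : M -> E -> R)
  (g : M -> E -> E -> R) (acm : almost_contact_metric phi xi eta g).
Implicit Types (p : M) (u v w : E) (a b : R) (X Y Z : vfield M).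

Let rg := acm_g acm.
Let ephi := acm_phi acm.
Let feta := acm_eta acm.

Lemma phiD p u v : phi p (u + v) = phi p u + phi p v.
Proof. by have := endo_linear ephi p 1 u v; rewrite !scale1r. Qed.

Lemma phi0 p : phi p 0 = 0.
Proof. by apply: (addrI (phi p 0)); rewrite -phiD !addr0. Qed.

Lemma phiZ p a u : phi p (a *: u) = a *: phi p u.
Proof. by have := endo_linear ephi p a u 0; rewrite phi0 !addr0. Qed.

Lemma phiN p u : phi p (- u) = - phi p u.
Proof. by rewrite -scaleN1r phiZ scaleN1r. Qed.

Lemma etaD p u v : eta p (u + v) = eta p u + eta p v.
Proof. by have := form_linear feta p 1 u v; rewrite scale1r mul1r. Qed.

Lemma eta0 p : eta p 0 = 0.
Proof. by apply: (addrI (eta p 0)); rewrite -etaD !addr0. Qed.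

Lemma etaZ p a u : eta p (a *: u) = a * eta p u.
Proof. by have := form_linear feta p a u 0; rewrite eta0 !addr0. Qed.

Lemma etaN p u : eta p (- u) = - eta p u.
Proof. by rewrite -scaleN1r etaZ mulN1r. Qed.

Lemma phi_phi p u : phi p (phi p u) = - u + eta p u *: xi p.
Proof. by have [X sX <-] := extend_vector p u; exact: (acm_phi2 acm sX). Qed.

Lemma eta_phi p u : eta p (phi p u) = 0.
Proof. by have [X sX <-] := extend_vector p u; exact: (acm_eta_phi acm sX). Qed.

Lemma eta_dual p u : eta p u = g p (xi p) u.
Proof. by have [X sX <-] := extend_vector p u; exact: (acm_dual acm sX). Qed.

Lemma metric_xi p u : g p u (xi p) = eta p u.
Proof. by rewrite eta_dual (Defs.metric_sym rg). Qed.

Lemma metric_phi p u v :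
  g p (phi p u) (phi p v) = g p u v - eta p u * eta p v.
Proof.
have [X sX <-] := extend_vector p u; have [Y sY <-] := extend_vector p v.
exact: (acm_compat acm sX sY).
Qed.

(** Compatibility with v replaced by phi v. *)
Lemma metric_phi_skew p u v : g p u (phi p v) = - g p (phi p u) v.
Proof.
have := metric_phi p u (phi p v); rewrite eta_phi mulr0 subr0 => <-.
by rewrite phi_phi !(metricE rg) metric_xi eta_phi mulr0 addr0.
Qed.

Definition acmE := (phiD, phiZ, phiN, etaD, etaZ, etaN).

(** The components of V depend jointly on the point and on t, so that the
    smoothness of phi and eta enters through their components in charts. *)
Lemma smooth_cone_J (V : vfield (line_product M)) : smooth_vfield V ->
  smooth_vfield (act (cone_J phi xi eta) V).
Proof.
move=> /smooth_lineP sV; apply/smooth_lineP => c k ac.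
have [CV cV] := sV c k ac; have oXT := @openXT _ _ M c.
have fE := @finite_coords_rV R d; split.
  have C1 : Ck k (ccod c `*` setT)
      (fun z => endo_local phi c z.1 (hor_local c V z)).
    apply: (Ck_app (T := fun z => endo_local phi c z.1) fE oXT _ _ CV).
      by move=> z _; exact: linear_endo_local.
    by move=> u; exact: (Ck_fst R (ccod_open c) (Ck_endo_local k u ephi ac)).
  have C2 := Ck_scale oXT cV (Ck_fst R (ccod_open c) (acm_xi acm ac k)).
  apply: Ck_ext oXT _ (Ck_add oXT C1 C2) => -[x s] [/= cx _].
  rewrite /endo_local /hor_local tvec_vlocal// /ver_local /=.
  transitivity (tcoord c (cinv c x) (ver V s (cinv c x) *: xi (cinv c x)
      + phi (cinv c x) (hor V s (cinv c x)))).
    by rewrite linear_tcoord addrC.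
  by rewrite addrC.
have C1 : Ck k (ccod c `*` setT)
    (fun z => form_local eta c z.1 (hor_local c V z)).
  apply: (Ck_app (T := fun z => form_local eta c z.1) fE oXT _ _ CV).
    by move=> z _; exact: linear_form_local.
  by move=> u; exact: (Ck_fst R (ccod_open c) (Ck_form_local k u feta ac)).
apply: Ck_ext oXT _ (Ck_scale oXT (Ck_cst _ _ (-1 : R)) C1) => -[x s] [/= cx _].
by rewrite /form_local /hor_local tvec_vlocal// /ver_local /= [_ *: _]mulN1r.
Qed.

Variables (nabla : vfield M -> vfield M -> vfield M)
  (lc : is_levi_civita g nabla).
Let cn := lc_connection lc.
Let sxi := acm_xi acm.

Lemma smooth_phi X : smooth_vfield X -> smooth_vfield (act phi X).
Proof. exact: endo_smooth. Qed.

Lemma smooth_fun_eta X : smooth_vfield X -> smooth_fun (pairing eta X).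
Proof. exact: form_smooth. Qed.

Lemma act_phi_xi : act phi xi = (fun=> 0).
Proof. by apply/funext => q; exact: (acm_phi_xi acm). Qed.

Lemma scale0_vfield X : (fun q => 0 *: X q) = (fun=> 0) :> vfield M.
Proof. by apply/funext => q; rewrite scale0r. Qed.

Lemma nabla0r X p : smooth_vfield X -> nabla X (fun=> 0) p = 0.
Proof.
move=> sX; have := conn_leibniz cn (@smooth_fun_cst _ _ M 0) sX sxi p.
by rewrite scale0_vfield lie_fun_cst !scale0r addr0.
Qed.

Lemma nabla0l Z p : smooth_vfield Z -> nabla (fun=> 0) Z p = 0.
Proof.
move=> sZ; have := connZl cn (@smooth_fun_cst _ _ M 0) sxi sZ p.
by rewrite scale0_vfield scale0r.
Qed.

(** The field xi has constant length 1. *)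
Lemma eta_nabla_xi X p : smooth_vfield X -> eta p (nabla X xi p) = 0.
Proof.
move=> sX; have := lc_metric lc sX sxi sxi p.
rewrite (_ : inner g xi xi = fun=> 1); last first.
  by apply/funext => q; rewrite /inner -eta_dual (acm_eta_xi acm).
rewrite lie_fun_cst metric_xi -eta_dual => e; lra.
Qed.

Lemma lie_fun_eta X Y p : smooth_vfield X -> smooth_vfield Y ->
  lie_fun X (pairing eta Y) p = g p (nabla X xi p) (Y p) + eta p (nabla X Y p).
Proof.
move=> sX sY; rewrite (_ : pairing eta Y = inner g xi Y).
  by rewrite (lc_metric lc sX sxi sY) eta_dual.
by apply/funext => q; rewrite /pairing /inner eta_dual.
Qed.

Lemma cov_phi_xi X p : smooth_vfield X ->
  cov_endo nabla phi X xi p = - phi p (nabla X xi p).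
Proof. by move=> sX; rewrite /cov_endo act_phi_xi nabla0r// sub0r. Qed.

Lemma h_tensorE X p : smooth_vfield X -> h_tensor phi xi X p =
  2^-1 *: (cov_endo nabla phi xi X p - nabla (act phi X) xi p
           + phi p (nabla X xi p)).
Proof.
move=> sX; rewrite /h_tensor /lie_endo /cov_endo.
rewrite -!(lc_torsion_free lc)//; last exact: smooth_phi.
congr (_ *: _); rewrite !acmE opprB addrACA.
move: (nabla _ _ p) (phi p _) (nabla _ _ p) (phi p _) => n1 n2 n3 n4.
by apply/rowP => i; rewrite !mxE; ring.
Qed.

Variables (nablabar : vfield (line_product M) -> vfield (line_product M) ->
  vfield (line_product M)) (lcbar : is_levi_civita (cone_metric g) nablabar).
Notation J := (cone_J phi xi eta).

Lemma hor_cone_J (V : vfield (line_product M)) t :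
  hor (act J V) t = (act phi (hor V t) \+ (fun q => ver V t q *: xi q)).
Proof. by []. Qed.

Lemma ver_cone_J (V : vfield (line_product M)) t :
  ver (act J V) t = (fun q => -1 * pairing eta (hor V t) q).
Proof. by apply/funext => q; rewrite mulN1r. Qed.

Lemma dt_hor_cone_J (V : vfield (line_product M)) p t : smooth_vfield V ->
  dt_hor (act J V) p t = phi p (dt_hor V p t) + dt_ver V p t *: xi p.
Proof.
move=> sV; have [_ dh _] := diff_hor p t sV; have [_ dv _] := diff_ver p t sV.
have fE := @finite_coords_rV R d.
have lphi : linear (phi p) := endo_linear ephi p.
have [d1 D1] := diff_linear_comp lphi (linear_continuous fE lphi) dh.
have lxi : linear (fun a : R => a *: xi p).
  by move=> a u v; rewrite scalerDl scalerA.
have [d2 D2] := diff_linear_comp lxi (linear_continuous finite_coords_real lxi) dv.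
have [_ D] := diff_addf d1 d2.
transitivity ('d (fun s => phi p (hor V s p) + ver V s p *: xi p) t 1).
  by [].
rewrite (congr1 (@^~ 1) D).
by congr (_ + _); [exact: (congr1 (@^~ 1) D1)|exact: (congr1 (@^~ 1) D2)].
Qed.

Lemma dt_ver_cone_J (V : vfield (line_product M)) p t : smooth_vfield V ->
  dt_ver (act J V) p t = - eta p (dt_hor V p t).
Proof.
move=> sV; have [_ dh _] := diff_hor p t sV.
have leta : linear (fun u => - eta p u).
  by move=> a u v; rewrite etaD etaZ opprD -mulrN.
have := diff_linear_comp leta (linear_continuous (@finite_coords_rV R d) leta) dh.
by move=> [_ D]; exact: (congr1 (@^~ 1) D).
Qed.

(** The t-derivatives of the components of V, and the d/dt-component of U, cancel:
    J is parallel along d/dt. *)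
Lemma cov_cone_J U V p t : smooth_vfield U -> smooth_vfield V ->
  let X := hor U t in let Y := hor V t in let b := ver V t p in
  cov_endo nablabar J U V (p, t) =
  (cov_endo nabla phi X Y p + b *: nabla X xi p + eta p (Y p) *: X p
     + b *: phi p (X p) - g p (X p) (Y p) *: xi p,
   g p (X p) (phi p (Y p)) - g p (nabla X xi p) (Y p)).
Proof.
move=> sU sV X Y b; have sJV := smooth_cone_J sV.
have sX : smooth_vfield X by exact: smooth_hor.
have sY : smooth_vfield Y by exact: smooth_hor.
have sb : smooth_fun (ver V t) by exact: smooth_ver.
rewrite /cov_endo !(cone_connE rg lc lcbar)// /cone_conn /cone_J /=.
rewrite hor_cone_J (connDr cn)//; last 2 first.
- exact: smooth_phi.
- exact: smooth_vfieldZ.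
rewrite (conn_leibniz cn sb sX sxi) ver_cone_J.
have -> : lie_fun X (fun q => -1 * pairing eta Y q) p =
    - (g p (nabla X xi p) (Y p) + eta p (nabla X Y p)).
  rewrite (lie_funM _ _ (@smooth_fun_cst _ _ M (-1)) (smooth_fun_eta sY)).
  by rewrite lie_fun_cst mul0r add0r mulN1r lie_fun_eta.
rewrite dt_hor_cone_J// dt_ver_cone_J// -/X -/Y -/b /pairing.
rewrite /act !acmE !(metricE rg) metric_xi /b.
congr (_, _) => /=.
  move: (nabla X _ p) (nabla X xi p) (phi p (nabla X Y p)) (phi p (dt_hor V p t))
    (X p) (phi p (X p)) (phi p (Y p)) (xi p) => n1 n2 n3 n4 x fx fy z.
  move: (lie_fun _ _ p) (dt_ver V p t) (ver U t p) (g p _ _) (eta p (Y p)) (ver V t p).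
  move=> l dv a m e b'.
  by apply/rowP => i; rewrite !mxE; ring.
move: (g p _ _) (g p _ _) (eta p _) (eta p _) (eta p (X p)) (eta p (Y p)).
move: (ver U t p) (ver V t p) => a b' m1 m2 e1 e2 e3 e4; ring.
Qed.

Lemma phi_xi p : phi p (xi p) = 0. Proof. exact: (acm_phi_xi acm). Qed.

Lemma eta_xi p : eta p (xi p) = 1. Proof. exact: (acm_eta_xi acm). Qed.

Lemma metric_xil p u : g p (xi p) u = eta p u.
Proof. by rewrite eta_dual. Qed.

(** The component along M of J (X + a d/dt). *)
Definition shift_xi X (a : M -> R) : vfield M :=
  act phi X \+ (fun q => a q *: xi q).

Lemma smooth_shift_xi X (a : M -> R) : smooth_vfield X -> smooth_fun a ->
  smooth_vfield (shift_xi X a).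
Proof.
by move=> sX sa; apply: smooth_vfieldD; [exact: smooth_phi|exact: smooth_vfieldZ].
Qed.

Lemma nabla_shift_xi X Z (a : M -> R) p :
  smooth_vfield X -> smooth_fun a -> smooth_vfield Z ->
  nabla (shift_xi X a) Z p = nabla (act phi X) Z p + a p *: nabla xi Z p.
Proof.
move=> sX sa sZ; rewrite (connDl cn)//; last 2 first.
- exact: smooth_phi.
- exact: smooth_vfieldZ.
by rewrite (connZl cn sa sxi sZ).
Qed.

(** The b-dependence comes from phi xi = 0, by which phi does not see the term
    b xi while its covariant derivative does. *)
Lemma cov_shift_xi X Y (a b : M -> R) p :
  smooth_vfield X -> smooth_vfield Y -> smooth_fun a -> smooth_fun b ->
  cov_endo nabla phi (shift_xi X a) (shift_xi Y b) p =
  cov_endo nabla phi (act phi X) (act phi Y) p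
  + a p *: cov_endo nabla phi xi (act phi Y) p
  - b p *: phi p (nabla (act phi X) xi p)
  - (a p * b p) *: phi p (nabla xi xi p).
Proof.
move=> sX sY sa sb; rewrite /cov_endo.
have sfY := smooth_phi sY; have sX' := smooth_shift_xi sX sa.
have -> : act phi (shift_xi Y b) = act phi (act phi Y).
  by apply/funext => q; rewrite /act /shift_xi /= phiD phiZ phi_xi scaler0 addr0.
rewrite (connDr cn)//; last exact: smooth_vfieldZ.
rewrite (conn_leibniz cn sb sX' sxi) !nabla_shift_xi//; last exact: smooth_phi.
rewrite !acmE phi_xi.
move: (nabla _ _ p) (nabla _ _ p) (phi p _) (phi p _) (phi p _) (phi p _).
move: (lie_fun _ _ p) (a p) (b p) => l a' b' n1 n2 n3 n4 n5 n6.
by apply/rowP => i; rewrite !mxE; ring.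
Qed.

Definition cov_sum X Y p :=
  cov_endo nabla phi X Y p + cov_endo nabla phi (act phi X) (act phi Y) p.

Lemma quasi_kaehler_tensor U V p t : smooth_vfield U -> smooth_vfield V ->
  let X := hor U t in let Y := hor V t in
  let a := ver U t p in let b := ver V t p in
  cov_endo nablabar J U V (p, t)
    + cov_endo nablabar J (act J U) (act J V) (p, t) =
  (cov_sum X Y p + a *: cov_endo nabla phi xi (act phi Y) p
     - b *: phi p (nabla (act phi X) xi p) - (a * b) *: phi p (nabla xi xi p)
     + b *: nabla X xi p - eta p (Y p) *: nabla (act phi X) xi p
     - (a * eta p (Y p)) *: nabla xi xi p + (2 * eta p (Y p)) *: X p
     + (2 * b) *: phi p (X p) - (2 * g p (X p) (Y p)) *: xi p,
   2 * g p (X p) (phi p (Y p)) - g p (nabla X xi p) (Y p)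
     - g p (nabla (act phi X) xi p) (phi p (Y p))
     - a * g p (nabla xi xi p) (phi p (Y p))).
Proof.
move=> sU sV X Y a b.
have sX : smooth_vfield X by exact: smooth_hor.
have sY : smooth_vfield Y by exact: smooth_hor.
have sa : smooth_fun (ver U t) by exact: smooth_ver.
have sb : smooth_fun (ver V t) by exact: smooth_ver.
rewrite (cov_cone_J p t sU sV).
rewrite (cov_cone_J p t (smooth_cone_J sU) (smooth_cone_J sV)).
rewrite !hor_cone_J ver_cone_J -/X -/Y -!/(shift_xi _ _).
rewrite cov_shift_xi// nabla_shift_xi// /cov_sum -/a -/b.
rewrite /shift_xi /pairing /act /= -/(act phi X) -/(act phi Y) -/a -/b.
rewrite !acmE !(metricE rg) !phi_phi !phi_xi !metric_xi !metric_xil.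
rewrite !(metricE rg) !metric_xi !eta_phi !eta_xi metric_phi metric_phi_skew.
rewrite !(eta_nabla_xi _ sxi) !eta_nabla_xi//; last exact: smooth_phi.
rewrite /pairing; congr (_, _) => /=.
  move: (cov_endo _ _ _ _ p) (cov_endo _ _ _ _ p) (cov_endo _ _ _ _ p)
    (phi p (nabla (act phi X) xi p)) (phi p (nabla xi xi p)) (nabla X xi p)
    (nabla (act phi X) xi p) (nabla xi xi p) (phi p (X p)) (X p) (xi p)
    => c1 c2 c3 n1 n2 n3 n4 n5 fx x z.
  move: (g p _ _) (eta p _) (eta p _) a b => m e1 e2 a' b'.
  by apply/rowP => i; rewrite !mxE; ring.
rewrite !(metric0r rg) eta0 etaD etaN etaZ eta_xi.
move: (g p _ _) (g p _ _) (g p _ _) (g p _ _) (eta p _) a b.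
by move=> m1 m2 m3 m4 e a' b'; ring.
Qed.

Lemma cov_sum_xir X p : smooth_vfield X ->
  cov_sum X xi p = - phi p (nabla X xi p).
Proof.
move=> sX; rewrite /cov_sum cov_phi_xi// /cov_endo !act_phi_xi.
have -> : act phi (fun=> 0) = (fun=> 0) by apply/funext => q; exact: phi0.
by rewrite nabla0r ?phi0 ?subr0 ?addr0//; exact: smooth_phi.
Qed.

Lemma cov_sum_xil Y p : smooth_vfield Y ->
  cov_sum xi Y p = cov_endo nabla phi xi Y p.
Proof.
move=> sY; have sfY := smooth_phi sY; have sffY := smooth_phi sfY.
by rewrite /cov_sum [X in _ + X]/cov_endo !act_phi_xi !nabla0l// phi0 subr0 addr0.
Qed.

Lemma phi_phi_nabla_xi X p : smooth_vfield X ->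
  phi p (phi p (nabla X xi p)) = - nabla X xi p.
Proof. by move=> sX; rewrite phi_phi eta_nabla_xi// scale0r addr0. Qed.

(** The tangential part of the quasi Kaehler condition for fields tangent
    to M. *)
Definition reduced_eq := forall X Y p, smooth_vfield X -> smooth_vfield Y ->
  cov_sum X Y p = (2 * g p (X p) (Y p)) *: xi p - (2 * eta p (Y p)) *: X p
    + eta p (Y p) *: nabla (act phi X) xi p.

Lemma nabla_phi_xi0 Z p : smooth_vfield Z -> nabla (act phi xi) Z p = 0.
Proof. by move=> sZ; rewrite act_phi_xi nabla0l. Qed.

Section Reduced.
Hypothesis red : reduced_eq.

Lemma reduced_phi_nabla_xi X p : smooth_vfield X ->
  phi p (nabla X xi p) =
  2 *: X p - (2 * eta p (X p)) *: xi p - nabla (act phi X) xi p.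
Proof.
move=> sX; have := red p sX sxi.
rewrite cov_sum_xir// metric_xi eta_xi mulr1 scale1r.
by move/(congr1 -%R); rewrite opprK => ->; rewrite opprD opprB.
Qed.

Lemma reduced_cov_xi Y p : smooth_vfield Y -> cov_endo nabla phi xi Y p = 0.
Proof.
move=> sY; have := red p sxi sY.
by rewrite cov_sum_xil// metric_xil nabla_phi_xi0// scaler0 addr0 subrr.
Qed.

Lemma reduced_nabla_xi_xi p : nabla xi xi p = 0.
Proof.
have := reduced_phi_nabla_xi p sxi.
rewrite eta_xi mulr1 nabla_phi_xi0// subrr subr0 => e.
by apply/oppr_inj; rewrite -phi_phi_nabla_xi// e phi0 oppr0.
Qed.

Lemma reduced_nabla_xi X p : smooth_vfield X ->
  nabla X xi p = phi p (nabla (act phi X) xi p) - 2 *: phi p (X p).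
Proof.
move=> sX; apply: oppr_inj; rewrite -phi_phi_nabla_xi// reduced_phi_nabla_xi//.
by rewrite !acmE phi_xi scaler0 subr0 opprB.
Qed.

Lemma reduced_h_tensor X p : smooth_vfield X ->
  h_tensor phi xi X p =
  X p - eta p (X p) *: xi p - nabla (act phi X) xi p.
Proof.
move=> sX; rewrite h_tensorE// reduced_cov_xi// reduced_phi_nabla_xi//.
move: (eta p _) (nabla _ _ p) => e n; move: (X p) (xi p) => x z.
by apply/rowP => i; rewrite !mxE; field.
Qed.

End Reduced.

(** From left to right, the tensor is evaluated on fields lifted from M.  From
    right to left, the reduced equation with Y = xi expresses nabla_X xi through
    nabla_{phi X} xi; the coefficient of b vanishes by this relation, and the
    d/dt-component by its pairing with Y.  The terms with a vanish since
    nabla_xi phi = 0 and nabla_xi xi = 0. *)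
Lemma quasi_kaehler_reduced :
  quasi_kaehler J nablabar <-> reduced_eq.
Proof.
split=> [qk X Y p sX sY|red U V sU sV [p t]].
  have s0 := @smooth_fun_cst _ _ M 0.
  have sU := smooth_lift sX s0; have sV := smooth_lift sY s0.
  have := qk _ _ sU sV (p, 0); rewrite (quasi_kaehler_tensor _ _ sU sV).
  move=> /(congr1 fst) /=.
  have -> : hor (lift X (fun=> 0)) 0 = X by [].
  have -> : hor (lift Y (fun=> 0)) 0 = Y by [].
  have -> : ver (lift X (fun=> 0)) 0 p = 0 by [].
  have -> : ver (lift Y (fun=> 0)) 0 p = 0 by [].
  rewrite !mul0r mulr0 !scale0r !(addr0, subr0) => /eqP.
  rewrite subr_eq0 => /eqP e; rewrite -e.
  move: (cov_sum _ _ _) (nabla _ _ p) (eta p _) (X p) => c n e' x.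
  by apply/rowP => i; rewrite !mxE; ring.
rewrite quasi_kaehler_tensor//.
have sX := smooth_hor t sU; have sY := smooth_hor t sV.
rewrite reduced_cov_xi// ?reduced_nabla_xi_xi//; last exact: smooth_phi.
rewrite (reduced_nabla_xi red _ sX) red//.
rewrite phi0 metric_phi_skew (metric_phi_skew p (nabla _ _ p)) !(metricE rg).
rewrite [g p 0 _](Defs.metric_sym rg) (metric0r rg); congr (_, _) => /=.
  move: (phi p (nabla (act phi (hor U t)) xi p)) (phi p (hor U t p)) => n fx.
  move: (nabla _ _ p) (eta p _) (g p _ _) => n' e m.
  move: (hor U t p) (xi p) => x z.
  move: (ver U t p) (ver V t p) => a b.
  by apply/rowP => i; rewrite !mxE; ring.
move: (g p _ _) (g p _ _) (ver U t p) => m1 m2 a; ring.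
Qed.

(** Putting Y = xi, and then X = xi, in the identity with h determines
    phi nabla xi and nabla_xi phi; the definition of h then expresses h through
    nabla xi alone, exactly as the reduced equation does. *)
Lemma reduced_h_identity :
  reduced_eq <->
  (forall X Y, smooth_vfield X -> smooth_vfield Y -> forall p,
     cov_sum X Y p = (2 * g p (X p) (Y p)) *: xi p - eta p (Y p) *: X p
       - (eta p (X p) * eta p (Y p)) *: xi p
       - eta p (Y p) *: h_tensor phi xi X p).
Proof.
split=> [red X Y sX sY p|hid X Y p sX sY].
  rewrite red// (reduced_h_tensor red)//.
  move: (eta p _) (eta p _) (nabla _ _ p) (g p _ _) => e e' n m.
  by move: (X p) (xi p) => x z; apply/rowP => i; rewrite !mxE; ring.
have phi_nabla Z : smooth_vfield Z -> phi p (nabla Z xi p) =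
    Z p - eta p (Z p) *: xi p + h_tensor phi xi Z p.
  move=> sZ; have := hid _ _ sZ sxi p.
  rewrite cov_sum_xir// metric_xi eta_xi mulr1 !scale1r => /(congr1 -%R).
  rewrite opprK => ->; move: (eta p _) (h_tensor _ _ _ _) => e h.
  by move: (Z p) (xi p) => x z; apply/rowP => i; rewrite !mxE; ring.
have h_xi : h_tensor phi xi xi p = 0.
  by rewrite h_tensorE// cov_phi_xi// nabla_phi_xi0// subr0 addNr scaler0.
have cov_xi Z : smooth_vfield Z -> cov_endo nabla phi xi Z p = 0.
  move=> sZ; have := hid _ _ sxi sZ p.
  rewrite cov_sum_xil// metric_xil eta_xi h_xi mul1r scaler0 subr0 => ->.
  by move: (eta p _) => e; move: (xi p) => z; apply/rowP => i; rewrite !mxE; ring.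
rewrite hid//.
suff -> : h_tensor phi xi X p =
    X p - eta p (X p) *: xi p - nabla (act phi X) xi p.
  move: (eta p _) (eta p _) (nabla _ _ p) (g p _ _) => e e' n m.
  by move: (X p) (xi p) => x z; apply/rowP => i; rewrite !mxE; ring.
have := h_tensorE p sX; rewrite cov_xi// phi_nabla//.
move: (eta p _) (nabla _ _ p) (h_tensor _ _ _ _) => e n h.
move: (X p) (xi p) => x z eh.
apply/rowP => i; have := congr1 (fun v : E => v 0 i) eh; rewrite !mxE => ehi.
lra.
Qed.

End AlmostContact.

Theorem theorem4p2 (R : realType) (n : nat) (M : manifold 'rV[R]_(n.*2.+1))
  (phi : M -> 'rV[R]_(n.*2.+1) -> 'rV[R]_(n.*2.+1)) (xi : vfield M)
  (eta : M -> 'rV[R]_(n.*2.+1) -> R)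
  (g : M -> 'rV[R]_(n.*2.+1) -> 'rV[R]_(n.*2.+1) -> R)
  (acmM : almost_contact_metric phi xi eta g)
  (nabla : vfield M -> vfield M -> vfield M)
  (lc_nabla : is_levi_civita g nabla)
  (nablabar : vfield (line_product M) -> vfield (line_product M) ->
              vfield (line_product M))
  (lc_nablabar : is_levi_civita (cone_metric g) nablabar) :
  quasi_contact_metric phi xi eta nablabar <->
  (forall X Y : vfield M, smooth_vfield X -> smooth_vfield Y -> forall p : M,
     cov_endo nabla phi X Y p
     + cov_endo nabla phi (act phi X) (act phi Y) p =
     (2 * g p (X p) (Y p)) *: xi p - eta p (Y p) *: X p
     - (eta p (X p) * eta p (Y p)) *: xi p
     - eta p (Y p) *: h_tensor phi xi X p).
Proof.
apply: iff_trans (quasi_kaehler_reduced acmM lc_nabla lc_nablabar) _.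
exact (reduced_h_identity acmM lc_nabla).
Qed.
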